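(* Let $X$ be a non-degenerate real random variable such that $\varphi(t):=\log \mathbb{E}[e^{tX}]$ is finite for all $t\ge 0$. Let $\{X_{i,j}:(i,j)\in\mathbb{N}^2\}$ be independent copies of $X$, let $\{N_n\}_{n\in\mathbb{N}}$ be a sequence of natural numbers with $\lim_{n\to\infty}e^{-cn}N_n=1$ for some $c>0$, and let $Z_n=\sum_{i=1}^{N_n}\prod_{j=1}^n e^{X_{i,j}}$. Let $c_1:=\varphi'(1)-\varphi(1)$. Then, as $n\to\infty$, in probability, $$e^{-(\varphi(1)+c)n}Z_n\to\begin{cases}1, & \text{if } c>c_1,\\ 1/2, & \text{if } c=c_1.\end{cases}$$
   Context: Non-degenerate means not almost surely constant. Under the hypothesis on $\varphi$, $\varphi$ is infinitely differentiable on $(0,\infty)$, and $c_1>0$. *)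

(* Defs.v *)
From mathcomp Require Import all_boot all_order all_algebra finmap.
From mathcomp Require Import all_classical all_reals all_analysis.

Set Implicit Arguments.
Unset Strict Implicit.
Unset Printing Implicit Defensive.

Import Order.TTheory GRing.Theory Num.Theory.
Import numFieldNormedType.Exports.

Local Open Scope classical_set_scope.
Local Open Scope ring_scope.

Section Probability.
Context d (T : measurableType d) (R : realType) (P : probability T R).

Definition non_degenerate (X : T -> R) :=
  ~ exists a : R, {ae P, forall w, X w = a}.

(* Extended-real valued: infinite exactly when the expectation is. *)
Definition log_mgf (X : T -> R) (t : R) : \bar R := lne ('M_P X t).

Definition mutually_independent (I : choiceType) (X : I -> {RV P >-> R}) :=
  forall (F : {fset I}) (A : I -> set R),
    (forall i, i \in F -> measurable (A i)) ->
    P (\bigcap_(i in [set` F]) (X i @^-1` A i)) =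
    (\prod_(i <- F) P (X i @^-1` A i))%E.

Definition cvg_in_probability (Y : nat -> T -> R) (Y0 : T -> R) :=
  forall eps : R, 0 < eps ->
    P [set w | eps < `|Y n w - Y0 w|] @[n --> \oo] --> 0%E.

(* Indices start at 0, so that i ranges over N n values and j over n values. *)
Definition sum_of_products (X : nat -> nat -> T -> R) (N : nat -> nat)
    (n : nat) (w : T) : R :=
  \sum_(i < N n) \prod_(j < n) expR (X i j w).

End Probability.

(* Equality in law; the laws are compared on measurable sets only, since the
   value of a measure on other sets carries no meaning. *)
Definition same_law d d' (T : measurableType d) (T' : measurableType d')
    (R : realType) (P : probability T R) (P' : probability T' R)
    (X : {RV P >-> R}) (X' : {RV P' >-> R}) :=
  forall A : set R, measurable A -> distribution P X A = distribution P' X' A.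

(* Main.v *)
Require Import Defs.
From mathcomp Require Import all_boot all_order all_algebra finmap.
From mathcomp Require Import all_classical all_reals all_analysis.
From mathcomp Require Import measurable_realfun ring lra.

(* Let W_(i,n) = exp(S_(i,n) - phi(1) n), where S_(i,n) is the i-th row sum, be the
   density of the exponential tilt, and let m = phi'(1) be the tilted mean of X.
   With L_i = S_(i,n) - (phi(1) + c) n, the normalised Z_n is the sum of the exp(L_i).
   Discarding the rows with L_i > 0 (there are none with high probability) leaves
   pairwise independent variables in [0, 1]; their total mean is close to the
   tilted probability of {L_i <= 0}, and both the total second moment and the
   expected number of discarded rows are at most N_n e^(-cn) times the tilted
   expectation of exp(-|L_i|).  So it suffices that, under the tilted law, L_i
   escapes from bounded sets and the probability of {L_i <= 0} tends to 1 if
   c > c1 and to 1/2 if c = c1.  Both facts follow from Lindeberg's replacement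
   of the centered tilted steps by symmetric coin flips +s or -s of the same
   variance, which changes the expectation of a test function f(./sqrt n) by
   O(1/sqrt n).  No Gaussian limit is needed: the coin walk is symmetric, and
   trigonometric test functions show that it does not concentrate near 0 at
   scale sqrt n. *)

Set Implicit Arguments.
Unset Strict Implicit.
Unset Printing Implicit Defensive.

Import Order.TTheory GRing.Theory Num.Theory.
Import numFieldNormedType.Exports.

Local Open Scope classical_set_scope.
Local Open Scope ring_scope.

(** * Third-order Taylor bounds and fair coin walks *)

Section Trig.
Context {R : realType}.
Implicit Types x h : R.

(** The mean value theorem, used in a chain: [x - sin x] has derivative [1 - cos x >= 0], which
    gives the lower bound. That bound is in turn the sign of the derivative of
    [x ^+ 2 / 2 - (1 - cos x)], and the resulting estimate of [1 - cos] gives the upper bound. *)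
Lemma sin_sub_bound h : 0 <= h -> (0 <= h - sin h) && (h - sin h <= h ^+ 3 / 2).
Proof.
move=> h0.
have D (x : R) : is_derive x 1 (fun x => x - sin x) (1 - cos x).
  exact: is_deriveB.
have C : continuous (fun x : R => x - sin x).
  by move=> x; apply: continuousB; [exact: cvg_id|exact: continuous_sin].
have H1 : forall h, 0 <= h -> 0 <= h - sin h.
  move=> {h0} {}h h0.
  have [c _] := MVT_segment h0 (fun x _ => D x) (continuous_subspaceT C).
  by rewrite sin0 !subr0 => ->; rewrite mulr_ge0// subr_ge0 cos_le1.
rewrite H1//=.
have H2 : forall h, 0 <= h -> 1 - cos h <= h ^+ 2 / 2.
  move=> {h0} {}h h0.
  have D' (x : R) : is_derive x 1 (fun x => x ^+ 2 / 2 - (1 - cos x)) (x - sin x).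
    apply: is_derive_eq.
    by rewrite /GRing.scale/=; field.
  have C' : continuous (fun x : R => x ^+ 2 / 2 - (1 - cos x)).
    by move=> x; apply/differentiable_continuous/derivable1_diffP; case: (D' x).
  have [c] := MVT_segment h0 (fun x _ => D' x) (continuous_subspaceT C').
  rewrite in_itv/= => /andP[c0 _].
  rewrite cos0 subrr expr0n/= mul0r subrr subr0 => E.
  by rewrite -subr_ge0 E mulr_ge0 ?subr0 ?H1.
have [c] := MVT_segment h0 (fun x _ => D x) (continuous_subspaceT C).
rewrite in_itv/= => /andP[c0 ch]; rewrite sin0 !subr0 => ->.
rewrite (_ : h ^+ 3 / 2 = h ^+ 2 / 2 * h); last by field.
rewrite ler_wpM2r//; apply: le_trans (H2 _ c0) _.
by rewrite ler_pM2r ?invr_gt0// ler_sqr.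
Qed.

Lemma abs_sin_sub h : `|sin h - h| <= `|h| ^+ 3.
Proof.
wlog h0 : h / 0 <= h.
  move=> H; have [/H//|h0] := leP 0 h.
  have := H (- h); rewrite sinN normrN opprK oppr_ge0 => /(_ (ltW h0)).
  by rewrite addrC distrC.
have /andP[a b] := sin_sub_bound h0.
rewrite distrC (ger0_norm h0) ger0_norm//; apply: le_trans b _.
by rewrite ler_pdivrMr// ler_peMr ?exprn_ge0// ler1n.
Qed.

(** By the half-angle formula the error equals [2 * (h / 2 - s) * (h / 2 + s)] with
    [s = sin (h / 2)]. The sine bound controls the first factor for [h <= 2]; beyond that,
    [h ^+ 2 / 2] is already below [h ^+ 3]. *)
Lemma abs_cos_sub h : `|cos h - 1 + h ^+ 2 / 2| <= `|h| ^+ 3.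
Proof.
wlog h0 : h / 0 <= h.
  move=> H; have [/H//|h0] := leP 0 h.
  have := H (- h); rewrite cosN normrN sqrrN oppr_ge0 => /(_ (ltW h0)).
  by [].
have h20 : 0 <= h / 2 by lra.
have /andP[a b] := sin_sub_bound h20.
have E : cos h = 1 - 2 * sin (h/2) ^+ 2.
  rewrite [in LHS](_ : h = (h/2) *+ 2); last by rewrite -mulr_natr; lra.
  by rewrite cos_mulr2n cos2sin2 -mulr_natr; lra.
rewrite E; set s := sin _ in a b *.
have s1 : - (h/2) <= s.
  have [|] := leP 0 s; first by lra.
  move=> s0; have := sin_geN1 (h/2); rewrite -/s.
  have [h1|h1] := leP 1 (h/2); first lra.
  move=> _; have : 0 <= s; last by lra.
  by apply: sin_ge0_pi; rewrite h20/=; have := @pi_ge2 R; lra.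
rewrite (ger0_norm h0).
have -> : 1 - 2 * s ^+ 2 - 1 + h ^+ 2 / 2 = 2 * (h / 2 - s) * (h/2 + s) by lra.
rewrite ger0_norm; last by rewrite !mulr_ge0//; lra.
have [h1|h1] := leP h 2.
  have b' : h / 2 - s <= h^+2 / 8.
    apply: le_trans b _.
    by rewrite (_ : (h/2)^+3/2 = h^+2/8 * (h/2)); [rewrite ler_piMr; nra | lra].
  have : (h/2+s) <= h by lra.
  have : 0 <= h / 2 + s by lra.
  nra.
have -> : 2 * (h / 2 - s) * (h / 2 + s) = h^+2/2 - 2 * s^+2 by lra.
have : h ^+ 2 * h >= h^+2 * 1 by rewrite ler_wpM2l ?sqr_ge0//; lra.
rewrite -exprSr.
have := sqr_ge0 s; have := sqr_ge0 h; lra.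
Qed.

Lemma cos_ge_half (u : R) : `|u| <= 1/2 -> 1 / 2 <= cos u.
Proof.
move=> u1; have := abs_cos_sub u; rewrite ler_norml => /andP[+ _].
rewrite -[u^+2]real_normK ?num_real//; move: (normr_ge0 u); set v := `|u| in u1 *.
move=> v0; rewrite exprS; have : v ^+ 2 <= 1/4 by nra.
have := sqr_ge0 v; nra.
Qed.

(** For [|u| <= 1/4] the cubic error costs at most half of the quadratic term, which leaves
    [1 - u ^+ 2 / 4]. *)
Lemma abs_cos_le_exp (u : R) : `|u| <= 1/4 -> `|cos u| <= expR (- (u ^+ 2 / 4)).
Proof.
move=> u1; rewrite ger0_norm; last first.
  by apply: le_trans (cos_ge_half (le_trans u1 _)) ; lra.
apply: le_trans (expR_ge1Dx _).
have := abs_cos_sub u; rewrite ler_norml => /andP[_].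
rewrite -[u^+2]real_normK ?num_real//; move: (normr_ge0 u); set v := `|u| in u1 *.
move=> v0; rewrite exprS; have := sqr_ge0 v; nra.
Qed.

End Trig.

Section Taylor.
Context {R : realType}.
Implicit Types (f g : R -> R) (a b x h s e t M N K : R).

(** [f1] and [f2] stand for the first two derivatives. Asking only for a uniform cubic remainder
    makes the class stable under linear combinations and affine substitutions without any
    differentiation; measurability allows [f1] and [f2] to be integrated. *)
Definition taylor3 M f := exists f1 f2 : R -> R,
  [/\ measurable_fun setT f, measurable_fun setT f1, measurable_fun setT f2 &
   forall x h, `|f (x + h) - (f x + h * f1 x + h ^+ 2 / 2 * f2 x)| <= M * `|h| ^+ 3].

Lemma taylor3_linear M N a b f g : taylor3 M f -> taylor3 N g ->
  taylor3 (`|a| * M + `|b| * N) (fun x => a * f x + b * g x).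
Proof.
move=> [f1 [f2 [mf mf1 mf2 Hf]]] [g1 [g2 [mg mg1 mg2 Hg]]].
exists (fun x => a * f1 x + b * g1 x), (fun x => a * f2 x + b * g2 x); split.
1-3: by apply: measurable_funD; apply: measurable_funM.
move=> x h.
rewrite (_ : _ - _ = a * (f (x + h) - (f x + h * f1 x + h ^+ 2 / 2 * f2 x)) +
  b * (g (x + h) - (g x + h * g1 x + h ^+ 2 / 2 * g2 x))); last by ring.
apply: le_trans (ler_normD _ _) _; rewrite !normrM mulrDl -(mulrA `|a|) -(mulrA `|b|).
by apply: lerD; apply: ler_wpM2l.
Qed.

Lemma taylor3_affine M a b f : taylor3 M f ->
  taylor3 (M * `|a| ^+ 3) (fun x => f (a * x + b)).
Proof.
move=> [f1 [f2 [mf mf1 mf2 Hf]]].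
have ma : measurable_fun setT (fun x : R => a * x + b).
  by apply: measurable_funD => //; apply: measurable_funM.
exists (fun x => a * f1 (a * x + b)), (fun x => a ^+ 2 * f2 (a * x + b)); split.
- exact: measurableT_comp.
- by apply: measurable_funM => //; exact: measurableT_comp.
- by apply: measurable_funM => //; exact: measurableT_comp.
move=> x h; rewrite -(mulrA M) -exprMn -normrM.
rewrite (_ : a * (x + h) + b = a * x + b + a * h); last by ring.
apply: le_trans (Hf _ _); rewrite le_eqVlt; apply/orP; left; apply/eqP.
by congr (`| _ - _|); field.
Qed.

Lemma taylor3_cst (c : R) : taylor3 0 (fun=> c).
Proof.
exists (fun=> 0), (fun=> 0); split=> // x h.
by rewrite !mulr0 !addr0 subrr normr0 mul0r.
Qed.

Lemma taylor3_cos (t : R) : taylor3 (2 * `|t| ^+ 3) (fun x => cos (t * x)).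
Proof.
suff /(taylor3_affine t 0) : taylor3 2 (@cos R).
  by congr (taylor3 _ _); apply/funext => x; rewrite addr0.
exists (fun x => - sin x), (fun x => - cos x); split.
- by apply: continuous_measurable_fun; exact: continuous_cos.
- apply: measurableT_comp => //.
  by apply: continuous_measurable_fun; exact: continuous_sin.
- apply: measurableT_comp => //.
  by apply: continuous_measurable_fun; exact: continuous_cos.
move=> x h; rewrite cosD.
rewrite (_ : _ - _ = cos x * (cos h - 1 + h ^+ 2 / 2) - sin x * (sin h - h)); last by field.
apply: le_trans (ler_normB _ _) _; rewrite !normrM mulr_natl mulr2n.
by apply: lerD; rewrite -[leRHS]mul1r ler_pM// ?cos_max ?sin_max ?abs_cos_sub ?abs_sin_sub.
Qed.

Definition cubic (x : R) : R := Num.max x 0 ^+ 3.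

(** For [x] and [x + h] both positive the remainder is exactly [h ^+ 3]; when the sign changes
    between them, [|x + h| <= |h|]. *)
Lemma taylor3_cubic : taylor3 1 cubic.
Proof.
have mm : measurable_fun setT (fun x : R => Num.max x 0).
  exact: measurable_maxr.
exists (fun x => 3 * Num.max x 0 ^+ 2), (fun x => 6 * Num.max x 0); split.
- exact: measurable_funX.
- by apply: measurable_funM => //; exact: measurable_funX.
- exact: measurable_funM.
move=> x h; rewrite /cubic mul1r.
have [xh|xh] := leP (x + h) 0; have [x0|x0] := leP x 0.
- by rewrite expr0n/= expr0n/= !mulr0 !addr0 subrr normr0 exprn_ge0.
- rewrite (_ : _ - _ = h ^+ 3 - (x + h) ^+ 3); last by field.
  have h0 : h < 0 by lra.
  have -> : h ^+ 3 - (x + h) ^+ 3 = - (`|h| ^+ 3 - `|x + h| ^+ 3).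
    by rewrite (ltr0_norm h0) (ler0_norm xh); ring.
  have : `|x + h| ^+ 3 <= `|h| ^+ 3.
    by rewrite lerXn2r ?nnegrE// (ltr0_norm h0) (ler0_norm xh); lra.
  rewrite normrN => ?; rewrite ger0_norm ?subr_ge0// lerBlDr lerDl exprn_ge0//.
- rewrite !expr0n/= !mulr0 !addr0 subr0 ger0_norm; last by rewrite exprn_ge0// ltW.
  have h0 : 0 < h by lra.
  by rewrite (gtr0_norm h0) lerXn2r// ?nnegrE; lra.
- rewrite (_ : _ - _ = h ^+ 3); last by field.
  by rewrite normrX.
Qed.

(* Integral of a quadratic B-spline, hence [C^2] with a Lipschitz second
   derivative. *)
Definition step (x : R) : R :=
  1 - (cubic x - 3 * cubic (x - 1) + 3 * cubic (x - 2) - cubic (x - 3)) / 6.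

Lemma step_le0 x : x <= 0 -> step x = 1.
Proof.
move=> x0; rewrite /step /cubic !max_r;
  [by rewrite !expr0n/= !mulr0 subrr addr0 subrr mul0r subr0|lra..].
Qed.

Lemma step_ge3 x : 3 <= x -> step x = 0.
Proof. by move=> x0; rewrite /step /cubic !max_l; [field|lra..]. Qed.

Lemma step_itv x : 0 <= step x <= 1.
Proof.
have [/step_le0 ->|x0] := leP x 0; first by rewrite ler01 lexx.
have [/step_ge3 ->|x3] := leP 3 x; first by rewrite ler01 lexx.
rewrite /step /cubic (@max_l _ _ x)//; last lra.
rewrite (@max_r _ _ (x - 3)); last lra.
have [x1|x1] := leP (x-1) 0; have [x2|x2] := leP (x-2) 0; try lra.
- rewrite !expr0n/=; apply/andP; split; last by have := exprn_ge0 3 (ltW x0); lra.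
  have : x ^+ 3 <= 1 by rewrite exprn_ile1//; lra.
  lra.
- rewrite !expr0n/=.
  rewrite (_ : x = (x - 1) + 1); last ring.
  set y := x - 1 in x1 *.
  have y1 : y <= 1 by rewrite /y; lra.
  rewrite (_ : _ - _ = (2 - 3 * y - 3 * y ^+ 2 + 2 * y ^+ 3 + 3) / 6); last by field.
  have := sqr_ge0 y.
  have : 0 <= (1 - y) ^+ 2 * (1 + 2 * y) by rewrite mulr_ge0 ?sqr_ge0//; lra.
  have -> : (1 - y) ^+ 2 * (1 + 2 * y) = 1 - 3 * y ^+ 2 + 2 * y ^+ 3 by ring.
  have : y ^+ 3 <= y ^+ 2 by rewrite exprS ler_piMl// sqr_ge0.
  lra.
- rewrite !expr0n/=.
  rewrite (_ : _ - _ = (3 - x) ^+ 3 / 6); last by field.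
  have : 0 <= (3 - x) ^+ 3 by rewrite exprn_ge0//; lra.
  have : (3 - x) ^+ 3 <= 1 by rewrite exprn_ile1//; lra.
  lra.
Qed.

(** The constant is [(1 + 3 + 3 + 1) / 6], from the coefficients of the four truncated cubics. *)
Lemma taylor3_step : taylor3 (4 / 3) step.
Proof.
have T a := taylor3_affine 1 a taylor3_cubic.
have T1 := taylor3_linear 1 (-3) (T 0) (T (-1)).
have T2 := taylor3_linear 3 (-1) (T (-2)) (T (-3)).
have T3 := taylor3_linear 1 1 T1 T2.
have := taylor3_linear 1 (- 6^-1) (taylor3_cst 1) T3.
rewrite !normrN !normr1 !expr1n !mul1r !mulr1 add0r.
rewrite !ger0_norm//; congr (taylor3 _ _); first by field.
by apply/funext => x; rewrite /step !mul1r !addr0; field.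
Qed.

(* [iter n (coin s) f x] is the expectation of [f] after [n] fair steps [+s] or [-s]
   from [x]. *)
Definition coin s f : R -> R := fun x => (f (x + s) + f (x - s)) / 2.

(** A mean of two translates keeps the same constant, so [M] does not grow along the iterates of
    [coin]. *)
Lemma taylor3_coin s M f : taylor3 M f -> taylor3 M (coin s f).
Proof.
move=> T; have := taylor3_linear 2^-1 2^-1 (taylor3_affine 1 s T) (taylor3_affine 1 (- s) T).
rewrite normr1 expr1n mulr1 ger0_norm//; congr (taylor3 _ _); first by field.
by apply/funext => x; rewrite /coin !mul1r; field.
Qed.

Lemma bounded_coin s K f : (forall x, `|f x| <= K) -> forall x, `|coin s f x| <= K.
Proof.
move=> H x; rewrite /coin normrM (@ger0_norm _ 2^-1)// ler_pdivrMr// mulr_natr mulr2n.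
by apply: le_trans (ler_normD _ _) _; apply: lerD.
Qed.

(** Expand at [h = 1] and [h = -1]: the difference of the two expansions isolates [f1], their sum
    isolates [f2]. *)
Lemma taylor3_bounded M K f f1 f2 : (forall x, `|f x| <= K) ->
  (forall x h, `|f (x + h) - (f x + h * f1 x + h ^+ 2 / 2 * f2 x)| <= M * `|h| ^+ 3) ->
  (forall x, `|f1 x| <= K + M) /\ (forall x, `|f2 x| <= 4 * K + 2 * M).
Proof.
move=> bf H; suff H' x : `|f1 x| <= K + M /\ `|f2 x| <= 4 * K + 2 * M.
  by split=> x; case: (H' x).
have := H x 1; have := H x (-1); have := bf x; have := bf (x + 1); have := bf (x - 1).
rewrite sqrrN normrN !normr1 expr1n mulr1 mulN1r mul1r !ler_norml.
by split; lra.
Qed.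

(** The first-order terms at [s] and [- s] cancel. *)
Lemma coin_approx s M f f1 f2 :
  (forall x h, `|f (x + h) - (f x + h * f1 x + h ^+ 2 / 2 * f2 x)| <= M * `|h| ^+ 3) ->
  forall x, `|coin s f x - (f x + s ^+ 2 / 2 * f2 x)| <= M * `|s| ^+ 3.
Proof.
move=> H x; have := H x s; have := H x (- s); rewrite /coin normrN sqrrN.
rewrite mulNr !ler_norml; lra.
Qed.

(** Telescoping over the steps: since [coin s] averages translates, the one-step bound [e] passes
    from [f] to [coin s f]. *)
Lemma iter_coin_close s e f : (forall x, `|coin s f x - f x| <= e) ->
  forall n x, `|iter n (coin s) f x - f x| <= n%:R * e.
Proof.
move=> H n; elim: n f H => [|n IH] f H x; first by rewrite subrr normr0 mul0r.
rewrite iterSr (_ : _ - _ =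
  (iter n (coin s) (coin s f) x - coin s f x) + (coin s f x - f x)); last by ring.
apply: le_trans (ler_normD _ _) _; rewrite -natr1 mulrDl mul1r lerD// IH// => y.
rewrite /coin (_ : _ - _ = ((f (y + s + s) + f (y + s - s)) / 2 - f (y + s) + ((f (y - s +
  s) + f (y - s - s)) / 2 - f (y - s))) / 2); last by field.
rewrite normrM (@ger0_norm _ 2^-1)// ler_pdivrMr// mulr_natr mulr2n.
by apply: le_trans (ler_normD _ _) _; apply: lerD; exact: H.
Qed.

(** Symmetry of the coin steps. At [x = 0] it gives a test function and its reflection the same
    expectation. *)
Lemma iter_coin_opp s f n x : iter n (coin s) (fun x => f (- x)) x = iter n (coin s) f (- x).
Proof.
elim: n x => //= n IH x; rewrite {1}/coin [in RHS]/coin -/(coin s) !IH addrC.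
by rewrite opprB opprD (addrC s).
Qed.

(** Cosines are eigenfunctions of [coin s], with eigenvalue [cos (t * s)]. *)
Lemma iter_coin_cos s t n x :
  iter n (coin s) (fun x => cos (t * x)) x = cos (t * s) ^+ n * cos (t * x).
Proof.
elim: n x => [|n IH] x; first by rewrite expr0 mul1r.
rewrite iterS {1}/coin !IH mulrDr mulrBr cosD cosB exprS; by field.
Qed.

End Taylor.

(** * Independence *)

Section Independence.
Context d (T : measurableType d) (R : realType) (P : probability T R).

Definition independent2 (U V : T -> R) := forall A B : set R,
  measurable A -> measurable B ->
  P ((U @^-1` A) `&` (V @^-1` B)) = (P (U @^-1` A) * P (V @^-1` B))%E.

Lemma independent2_comp (U V : T -> R) (F G : R -> R) :
  measurable_fun setT F -> measurable_fun setT G ->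
  independent2 U V -> independent2 (F \o U) (G \o V).
Proof.
move=> mF mG UV A B mA mB; apply: (UV (F @^-1` A) (G @^-1` B)).
- by rewrite -[_ @^-1` _]setTI; exact: mF.
- by rewrite -[_ @^-1` _]setTI; exact: mG.
Qed.

(** Dynkin's theorem: the sets independent of a fixed [E] form a Dynkin system, which contains the
    pi-system [G]. *)
Lemma independent_sigma (G : set (set T)) (E : set T) :
  measurable E -> G `<=` measurable -> setI_closed G ->
  (forall A, G A -> P (E `&` A) = P E * P A)%E ->
  forall A, <<s G >> A -> (P (E `&` A) = P E * P A)%E.
Proof.
move=> mE Gm GI H.
have sm : <<s G >> `<=` measurable.
  by apply: smallest_sub => //; exact: sigma_algebra_measurable.
apply: (@dynkin_induction _ (g_sigma_algebraType G) G) => //.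
- by rewrite setIT probability_setT mule1.
- move=> A /sm mA EA.
  rewrite probability_setC// muleBr ?fin_num_measure ?mule1// -?EA.
  rewrite -measureD//; last by rewrite ltey_eq fin_num_measure.
- move=> F mF tF EF; have {}mF n : d.-measurable (F n) by apply: sm; exact: mF.
  rewrite setI_bigcupr.
  have tEF : trivIset setT (fun i => E `&` F i) by exact: trivIset_setIl.
  rewrite measure_bigcup//; last by move=> i _; exact: measurableI.
  rewrite measure_bigcup//.
  rewrite -(fineK (fin_num_measure P _ mE)) -nneseriesZl//.
  by apply: eq_eseriesr => i _; rewrite fineK ?fin_num_measure//; exact: EF.
Qed.

(** Independence makes the joint law agree with the product of the marginal laws, first on
    rectangles and then everywhere by uniqueness. Tonelli then gives integrability of the product
    and Fubini its value. *)
Lemma expectation_indep (U V : T -> R) :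
  independent2 U V ->
  P.-integrable setT (EFin \o U) -> P.-integrable setT (EFin \o V) ->
  P.-integrable setT (EFin \o (U \* V)%R) /\
  \int[P]_w (U w * V w) = \int[P]_w U w * \int[P]_w V w.
Proof.
move=> UV iU iV.
have mU : measurable_fun setT U by apply/measurable_EFinP; case/integrableP : iU.
have mV : measurable_fun setT V by apply/measurable_EFinP; case/integrableP : iV.
pose X : {mfun T >-> R} := mfun_Sub (mem_set mU).
pose Y : {mfun T >-> R} := mfun_Sub (mem_set mV).
have mUV : measurable_fun setT (fun w => (U w, V w)) by exact: measurable_fun_pair.
pose XY : {mfun T >-> (R * R)%type} := mfun_Sub (mem_set mUV).
have law A : measurable A ->
    (distribution P X \x distribution P Y)%E A = distribution P XY A.
  apply: product_measure_unique => {}A B mA mB.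
  exact: UV.
have mmul : measurable_fun setT (fun z : R * R => z.1 * z.2).
  by apply: measurable_funM; [exact: measurable_fst|exact: measurable_snd].
have mabs : measurable_fun setT (fun x : R => `|x|%:E).
  by apply/measurable_EFinP; exact: normr_measurable.
have iUV : P.-integrable setT (EFin \o (U \* V)%R).
  apply/integrableP; split.
    by apply/measurable_EFinP; exact: measurable_funM.
  have := @ge0_integral_distribution _ _ _ _ _ P XY (fun z => `|z.1 * z.2|%:E).
  move=> <-//; last by apply/measurable_EFinP; exact: measurableT_comp.
  rewrite (eq_measure_integral (distribution P X \x distribution P Y)%E); last first.
    by move=> A mA _; apply/esym; exact: law.
  rewrite fubini_tonelli1//; last by apply/measurable_EFinP; exact: measurableT_comp.
  rewrite /fubini_F/=.
  under eq_integral.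
    move=> x _; under eq_integral do rewrite normrM EFinM.
    rewrite ge0_integralZl//.
    over.
  rewrite ge0_integralZr//; last exact: integral_ge0.
  rewrite !ge0_integral_distribution//.
  case/integrableP : iU => _ iU; case/integrableP : iV => _ iV.
  apply: lte_mul_pinfty => //.
    by apply: integral_ge0 => x _ /=; rewrite lee_fin.
  by rewrite ge0_fin_numE//; apply: integral_ge0 => x _ /=; rewrite lee_fin.
split=> //.
have iXY : (distribution P X \x distribution P Y)%E.-integrable setT (fun z => (z.1 * z.2)%:E).
  have [_ h] := integrableP _ _ _ iUV.
  apply/integrableP; split; first exact/measurable_EFinP.
  rewrite (eq_measure_integral (distribution P XY)); last by move=> A mA _; exact: law.
  rewrite ge0_integral_distribution//.
  by apply: measurableT_comp => //; exact/measurable_EFinP.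
apply: EFin_inj; rewrite EFinM /Rintegral !fineK; try exact: integrable_fin_num.
have <- := @integral_distribution _ _ _ _ _ P XY (fun z => (z.1 * z.2)%:E); last 2 first.
  exact/measurable_EFinP.
  exact: iUV.
rewrite (eq_measure_integral (distribution P X \x distribution P Y)%E); last first.
  by move=> A mA _; apply/esym; exact: law.
rewrite -integral12_prod_meas1//= /fubini_F/=.
have iY : (distribution P Y).-integrable setT (EFin : R -> \bar R).
  exact: integrable_pushforward.
have iX : (distribution P X).-integrable setT (EFin : R -> \bar R).
  exact: integrable_pushforward.
under eq_integral.
  move=> x _; under eq_integral do rewrite EFinM.
  rewrite integralZl//.
  over.
have -> : (\int[distribution P Y]_x x%:E = \int[P]_w (V w)%:E)%E.
  exact: integral_distribution.
rewrite -[in LHS](fineK (integrable_fin_num _ iV))// integralZr//.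
rewrite fineK; last exact: integrable_fin_num.
congr (_ * _)%E.
exact: integral_distribution.
Qed.

End Independence.

(** * Independence of functions of disjoint groups of variables *)

Section Grouping.
Context d (T : measurableType d) (R : realType) (P : probability T R).
Context (I : choiceType) (X : I -> {RV P >-> R}).

(** A pi-system generating the sigma-algebra of the variables indexed by [J]. Measurability on
    [g_sigma_algebraType (cylinders J)] expresses dependence on these variables alone. *)
Definition cylinders (J : {fset I}) : set (set T) :=
  [set C | exists2 A : I -> set R, forall i, measurable (A i) &
     C = \bigcap_(i in [set` J]) (X i @^-1` A i)].

Lemma measurable_RV_preimage i (A : set R) : measurable A -> measurable (X i @^-1` A).
Proof. by move=> mA; rewrite -[X in measurable X]setTI; exact: measurable_funP. Qed.

Lemma cylinders_measurable J : cylinders J `<=` measurable.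
Proof.
move=> _ [A mA ->]; apply: fin_bigcap_measurable => // i _.
exact: measurable_RV_preimage.
Qed.

Lemma setI_closed_cylinders J : setI_closed (cylinders J).
Proof.
move=> _ _ [A mA ->] [B mB ->]; exists (fun i => A i `&` B i).
  by move=> i; exact: measurableI.
by rewrite -bigcapI.
Qed.

Lemma measurable_cylinders J i : i \in J ->
  measurable_fun setT (X i : g_sigma_algebraType (cylinders J) -> R).
Proof.
move=> iJ _ B mB; rewrite setTI; apply: sub_gen_smallest.
exists (fun j => if j == i then B else setT).
  by move=> j; case: ifP.
apply/seteqP; split => [w /= Bw j _ /=|w /(_ i iJ) /=]; last by rewrite eqxx.
by case: eqP => // ->.
Qed.

(** [independent_sigma] is applied once for each group, the event of the other group being fixed;
    this reduces the claim to a pair of cylinders. *)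
Lemma independent_groups J K (U V : T -> R) :
  mutually_independent X -> [disjoint J & K]%fset ->
  measurable_fun setT (U : g_sigma_algebraType (cylinders J) -> R) ->
  measurable_fun setT (V : g_sigma_algebraType (cylinders K) -> R) ->
  independent2 P U V.
Proof.
move=> indX JK mU mV A B mA mB.
have mU' : <<s cylinders J >> (U @^-1` A) by have := mU measurableT _ mA; rewrite setTI.
have mV' : <<s cylinders K >> (V @^-1` B) by have := mV measurableT _ mB; rewrite setTI.
have sm L : <<s cylinders L >> `<=` measurable.
  apply: smallest_sub; last exact: cylinders_measurable.
  exact: sigma_algebra_measurable.
apply: (independent_sigma (sm _ _ mU') (@cylinders_measurable K)
  (@setI_closed_cylinders K)) => //.
move=> C KC; have mC := cylinders_measurable KC.
rewrite setIC muleC.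
apply: (independent_sigma mC (@cylinders_measurable J) (@setI_closed_cylinders J)) => //.
move=> {mU' mV' mA mB A B} D [A mA ->]; case: KC => {mC C} B mB ->.
(* As [J] and [K] are disjoint, a single family of sets describes both cylinders, and the
   independence of the variables indexed by the union applies to it. *)
pose F i := if i \in J then A i else B i.
have mF i : measurable (F i) by rewrite /F; case: ifP.
have FJ i : i \in J -> F i = A i by rewrite /F => ->.
have FK i : i \in K -> F i = B i.
  move=> iK; rewrite /F ifF//; apply/negbTE/negP => iJ.
  by move/fdisjointP : JK => /(_ i iJ); rewrite iK.
have -> : \bigcap_(i in [set` K]) (X i @^-1` B i) `&`
          \bigcap_(i in [set` J]) (X i @^-1` A i) =
          \bigcap_(i in [set` (J `|` K)%fset]) (X i @^-1` F i).
  rewrite set_fsetU bigcap_setU setIC; congr (_ `&` _).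
    by apply: eq_bigcapr => i /= iL; rewrite FJ.
  by apply: eq_bigcapr => i /= iL; rewrite FK.
rewrite !indX//.
rewrite (perm_big (K ++ J)%SEQ)/=; last first.
  apply: uniq_perm; rewrite ?fset_uniq// ?cat_uniq ?fset_uniq//= ?andbT.
    by apply/hasPn => i iJ; move/fdisjointP : JK => /(_ i iJ).
  by move=> i; rewrite mem_cat inE orbC.
rewrite big_cat/=; congr (_ * _)%E.
  by apply: eq_big_seq => i iL; rewrite FK.
by apply: eq_big_seq => i iL; rewrite FJ.
Qed.

End Grouping.

(** * Weighted expectations *)

Section BoundedMeasurable.
Context {R : realType}.
Implicit Types g h : R -> R.

Definition bmeas (g : R -> R) :=
  measurable_fun setT g /\ exists K, forall x, `|g x| <= K.

Lemma bmeas_cst k : bmeas (fun=> k).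
Proof. by split=> //; exists `|k|. Qed.

Lemma bmeasD g h : bmeas g -> bmeas h -> bmeas (fun x => g x + h x).
Proof.
move=> [mg [K Kg]] [mh [L Lh]]; split; first exact: measurable_funD.
by exists (K + L) => x; apply: le_trans (ler_normD _ _) _; apply: lerD.
Qed.

Lemma bmeasM g h : bmeas g -> bmeas h -> bmeas (fun x => g x * h x).
Proof.
move=> [mg [K Kg]] [mh [L Lh]]; split; first exact: measurable_funM.
by exists (K * L) => x; rewrite normrM; apply: ler_pM.
Qed.

Lemma bmeasZ k g : bmeas g -> bmeas (fun x => k * g x).
Proof. by move=> bg; apply: bmeasM => //; exact: bmeas_cst. Qed.

Lemma bmeas_sum (I : Type) (s : seq I) (g : I -> R -> R) :
  (forall i, bmeas (g i)) -> bmeas (fun x => \sum_(i <- s) g i x).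
Proof.
move=> bg; elim: s => [|i s IH].
  by under eq_fun do rewrite big_nil; exact: bmeas_cst.
by under eq_fun do rewrite big_cons; exact: bmeasD.
Qed.

Lemma bmeas_indic (A : set R) : measurable A -> bmeas \1_A.
Proof.
move=> mA; split; first exact: measurable_indic.
by exists 1 => x; rewrite indicE; case: (_ \in _); rewrite ?normr1 ?normr0.
Qed.

End BoundedMeasurable.

Section Rint.
Context d (T : measurableType d) (R : realType) (P : probability T R).
Implicit Types f g h : T -> R.

Local Notation intg f := (P.-integrable setT (EFin \o f)).

Lemma intg_meas f : intg f -> measurable_fun setT f.
Proof. by case/integrableP => /measurable_EFinP. Qed.

Lemma intgD f g : intg f -> intg g -> intg (fun w => f w + g w).
Proof. by move=> fi gi; have := integrableD measurableT fi gi. Qed.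

Lemma intgB f g : intg f -> intg g -> intg (fun w => f w - g w).
Proof. by move=> fi gi; have := integrableB measurableT fi gi. Qed.

Lemma intgZ (k : R) f : intg f -> intg (fun w => k * f w).
Proof. by move=> fi; have := integrableZl measurableT k fi. Qed.

Lemma intg_cst (k : R) : intg (fun=> k).
Proof. exact: finite_measure_integrable_cst. Qed.

Lemma intg_dom f g : measurable_fun setT f -> (forall w, `|f w| <= g w) ->
  intg g -> intg f.
Proof.
move=> mf fg; apply: le_integrable => //; first exact/measurable_EFinP.
move=> w _ /=; rewrite lee_fin; apply: le_trans (fg w) _; exact: ler_norm.
Qed.

Lemma intg_sum (I : Type) (s : seq I) (f : I -> T -> R) :
  (forall i, intg (f i)) -> intg (fun w => \sum_(i <- s) f i w).
Proof.
move=> fi; have := integrable_sum measurableT s (fun i (_ : true) => fi i).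
by apply: eq_integrable => // w _ /=; rewrite sumEFin.
Qed.

Lemma Rint_sum (I : Type) (s : seq I) (f : I -> T -> R) :
  (forall i, intg (f i)) ->
  \int[P]_w (\sum_(i <- s) f i w) = \sum_(i <- s) \int[P]_w f i w.
Proof.
move=> fi; elim: s => [|i s IH].
  under eq_Rintegral do rewrite big_nil.
  by rewrite big_nil Rintegral_cst// mul0r.
under eq_Rintegral do rewrite big_cons.
by rewrite RintegralD// ?IH ?big_cons//; exact: intg_sum.
Qed.

Lemma Rint_cst (k : R) : \int[P]_w k = k.
Proof. by rewrite Rintegral_cst//; have /= -> := @probability_setT _ _ _ P; rewrite mulr1. Qed.

Lemma le_Rint f g : intg f -> intg g -> (forall w, f w <= g w) ->
  \int[P]_w f w <= \int[P]_w g w.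
Proof. by move=> *; apply: le_Rintegral. Qed.

Lemma Rint_close f g h : intg f -> intg g -> intg h ->
  (forall w, `|f w - g w| <= h w) ->
  `|\int[P]_w f w - \int[P]_w g w| <= \int[P]_w h w.
Proof.
move=> fi gi hi H; rewrite -RintegralB//.
apply: le_trans (le_normr_Rintegral _ _) _ => //; first exact: intgB.
apply: le_Rint => //.
exact: integrable_norm (intgB fi gi).
Qed.

Section Weighted.
Context (u D : T -> R).
Hypotheses (u0 : forall w, 0 <= u w) (ui : intg u) (u1 : \int[P]_w u w = 1)
  (mD : measurable_fun setT D).

(** The expectation of [g] at [D] under the probability with density [u]; the change of measure
    stays inside the integrand. *)
Definition wexp (g : R -> R) : R := \int[P]_w (u w * g (D w)).

Lemma wexp_intg (g : R -> R) : bmeas g -> intg (fun w => u w * g (D w)).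
Proof.
move=> [mg [K Kg]]; have um := intg_meas ui.
apply: (@intg_dom _ (fun w => K * u w)).
- by apply: measurable_funM => //; exact: measurableT_comp.
- by move=> w; rewrite normrM (ger0_norm (u0 w)) mulrC ler_wpM2r.
- exact: intgZ.
Qed.

Lemma wexpD (g h : R -> R) : bmeas g -> bmeas h -> wexp (fun x => g x + h x) = wexp g + wexp h.
Proof.
move=> bg bh; rewrite -RintegralD//; try exact: wexp_intg.
by apply: eq_Rintegral => w _; rewrite mulrDr.
Qed.

Lemma wexpZ k (g : R -> R) : bmeas g -> wexp (fun x => k * g x) = k * wexp g.
Proof.
move=> bg; rewrite -RintegralZl//; last exact: wexp_intg.
by apply: eq_Rintegral => w _; rewrite mulrCA.
Qed.

Lemma wexp_cst k : wexp (fun=> k) = k.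
Proof. by rewrite /wexp RintegralZr// u1 mul1r. Qed.

Lemma wexp_le (g h : R -> R) : bmeas g -> bmeas h -> (forall x, g x <= h x) -> wexp g <= wexp h.
Proof.
by move=> bg bh gh; apply: le_Rint => [||w]; [exact: wexp_intg..|rewrite ler_wpM2l].
Qed.

Lemma wexp_sum (I : Type) (s : seq I) (g : I -> R -> R) :
  (forall i, bmeas (g i)) -> wexp (fun x => \sum_(i <- s) g i x) = \sum_(i <- s) wexp (g i).
Proof.
move=> bg; rewrite -Rint_sum => [|i]; last exact: wexp_intg.
by apply: eq_Rintegral => w _; rewrite mulr_sumr.
Qed.

Lemma wexp_close (g h : R -> R) e : bmeas g -> bmeas h -> (forall x, `|g x - h x| <= e) ->
  `|wexp g - wexp h| <= e.
Proof.
move=> bg bh gh; rewrite -[leRHS]wexp_cst; apply: Rint_close.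
- exact: wexp_intg.
- exact: wexp_intg.
- exact/wexp_intg/bmeas_cst.
- by move=> w; rewrite -mulrBr normrM (ger0_norm (u0 w)) ler_wpM2l.
Qed.

End Weighted.
End Rint.

Arguments wexp {d T R} P u D g.

(** * Lindeberg replacement under the exponential tilt *)

(** The value alone would not suffice: the real-valued integral takes a default value when the
    extended one is infinite. *)
Definition has_int d (T : measurableType d) (R : realType) (P : probability T R)
    (f : T -> R) (v : R) :=
  P.-integrable setT (EFin \o f) /\ \int[P]_w f w = v.

Section Lindeberg.
Context d (T : measurableType d) (R : realType) (P : probability T R).
Variables (Z : nat -> T -> R) (phi m s rho : R).

Definition row_sum n w := \sum_(j < n) Z j w.
(** With [phi] the log-moment generating function at 1, this is the density of the exponential tilt
    of the first [n] steps. The moment hypotheses below then say that a tilted step has mean [m],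
    variance [s ^+ 2] and third absolute central moment [rho]. *)
Definition tilt n w := expR (row_sum n w - phi * n%:R).
Definition centered n w := row_sum n w - m * n%:R.

Hypotheses (mZ : forall j, measurable_fun setT (Z j))
  (indZ : forall n, independent2 P (row_sum n) (Z n))
  (mom0 : forall j, has_int P (fun w => expR (Z j w - phi)) 1)
  (mom1 : forall j, has_int P (fun w => expR (Z j w - phi) * (Z j w - m)) 0)
  (mom2 : forall j, has_int P (fun w => expR (Z j w - phi) * (Z j w - m) ^+ 2) (s ^+ 2))
  (mom3 : forall j, has_int P (fun w => expR (Z j w - phi) * `|Z j w - m| ^+ 3) rho).

Lemma measurable_row_sum n : measurable_fun setT (row_sum n).
Proof. by apply: measurable_sum. Qed.

Lemma measurable_centered n : measurable_fun setT (centered n).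
Proof. by apply: measurable_funB => //; exact: measurable_row_sum. Qed.

Lemma row_sumS n w : row_sum n.+1 w = row_sum n w + Z n w.
Proof. by rewrite /row_sum big_ord_recr. Qed.

Lemma tiltS n w : tilt n.+1 w = tilt n w * expR (Z n w - phi).
Proof. by rewrite /tilt row_sumS -expRD -natr1; congr expR; ring. Qed.

Lemma centeredS n w : centered n.+1 w = centered n w + (Z n w - m).
Proof. by rewrite /centered row_sumS -natr1; ring. Qed.

Lemma has_int_indep n (F G : R -> R) a b :
  measurable_fun setT F -> measurable_fun setT G ->
  has_int P (fun w => F (row_sum n w)) a -> has_int P (fun w => G (Z n w)) b ->
  has_int P (fun w => F (row_sum n w) * G (Z n w)) (a * b).
Proof.
move=> mF mG [Fi <-] [Gi <-].
by have := expectation_indep (independent2_comp mF mG (indZ n)) Fi Gi.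
Qed.

Lemma measurable_tilt (a b : R) : measurable_fun setT (fun x => expR (a * x - b)).
Proof.
apply: measurableT_comp; first exact: measurable_expR.
by apply: measurable_funB => //; exact: measurable_funM.
Qed.

(** Each new step multiplies the density by an independent factor of mean 1. *)
Lemma has_int_tilt n : has_int P (tilt n) 1.
Proof.
elim: n => [|n IH].
  rewrite (_ : tilt 0 = fun=> 1); first by split; [exact: intg_cst|exact: Rint_cst].
  by apply/funext => w; rewrite /tilt /row_sum big_ord0 mulr0 subrr expR0.
rewrite (_ : tilt _ = fun w => expR (1 * row_sum n w - phi * n%:R) * expR (1 * Z n w - phi)).
  rewrite -[X in has_int P _ X]mulr1.
  apply: (has_int_indep (measurable_tilt 1 _) (measurable_tilt 1 _)).
    by under eq_fun do rewrite mul1r.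
  by under eq_fun do rewrite mul1r.
by apply/funext => w; rewrite !mul1r -tiltS.
Qed.

Definition tilted_exp n (g : R -> R) : R := wexp P (tilt n) (centered n) g.

(** The weight and the position at time [n] are functions of [row_sum n], hence independent of the
    next step; this is the factorisation that every term of the Taylor expansion uses. *)
Lemma has_int_step n (g k : R -> R) b : bmeas g -> measurable_fun setT k ->
  has_int P (fun w => expR (Z n w - phi) * k (Z n w - m)) b ->
  has_int P (fun w => tilt n w * g (centered n w) *
                      (expR (Z n w - phi) * k (Z n w - m))) (tilted_exp n g * b).
Proof.
move=> bg mk Hb; have [ti t1] := has_int_tilt n; have mg := bg.1.
apply: (@has_int_indep n (fun x => expR (x - phi * n%:R) * g (x - m * n%:R))
  (fun x => expR (x - phi) * k (x - m))) => //.
- apply: measurable_funM; first by apply: measurableT_comp => //; exact: measurable_funB.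
  by apply: measurableT_comp => //; exact: measurable_funB.
- apply: measurable_funM; first by apply: measurableT_comp => //; exact: measurable_funB.
  by apply: measurableT_comp => //; exact: measurable_funB.
- split=> //; apply: (@wexp_intg _ _ _ P (tilt n) (centered n)) => //.
  + by move=> w; exact: expR_ge0.
  + exact: measurable_centered.
Qed.

(* Both sides expand to [f + s^2/2 f''] at the previous position, up to the third-order
   remainder; independence factors the expansion of the true step. *)
Lemma lindeberg_step n M f : 0 <= M -> taylor3 M f -> (exists K, forall x, `|f x| <= K) ->
  `|tilted_exp n.+1 f - tilted_exp n (coin s f)| <= M * (rho + `|s| ^+ 3).
Proof.
move=> M0 [f1 [f2 [mf mf1 mf2 Hf]]] [K Kf].
have [Kf1 Kf2] := taylor3_bounded Kf Hf.
have bf : bmeas f by split=> //; exists K.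
have bf1 : bmeas f1 by split=> //; exists (K + M).
have bf2 : bmeas f2 by split=> //; exists (4 * K + 2 * M).
have bc : bmeas (coin s f).
  have [? [? [? _ _ _]]] : taylor3 M (coin s f) by apply: taylor3_coin; exists f1, f2.
  by split => //; exists K; exact: bounded_coin.
have t0 k w : 0 <= tilt k w by exact: expR_ge0.
have [ti t1] := has_int_tilt n; have [ti' t1'] := has_int_tilt n.+1.
have mc := measurable_centered n; have mc' := measurable_centered n.+1.
have m1 : measurable_fun setT (fun=> 1 : R) by [].
have [I0 E0] : has_int P (fun w => tilt n w * f (centered n w) * (expR (Z n w - phi) * 1))
  (tilted_exp n f * 1).
  by apply: (@has_int_step n f (fun=> 1)) => //; under eq_fun do rewrite mulr1.
have [I1 E1] : has_int P (fun w => tilt n w * f1 (centered n w) * (expR (Z n w - phi) *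
  (Z n w - m))) (tilted_exp n f1 * 0).
  exact: (@has_int_step n f1 id).
have [I2 E2] : has_int P (fun w => tilt n w * f2 (centered n w) * (expR (Z n w - phi) *
  (Z n w - m) ^+ 2)) (tilted_exp n f2 * s ^+ 2).
  exact: (@has_int_step n f2 (fun x => x ^+ 2)).
have [I3 E3] : has_int P (fun w => tilt n w * 1 * (expR (Z n w - phi) * `|Z n w - m| ^+ 3))
  (tilted_exp n (fun=> 1) * rho).
  apply: (@has_int_step n (fun=> 1) (fun x => `|x| ^+ 3)) => //; first exact: bmeas_cst.
  by apply: measurable_funX; exact: normr_measurable.
have step1 : `|tilted_exp n.+1 f - (tilted_exp n f + s ^+ 2 / 2 * tilted_exp n f2)| <= M * rho.
  have -> : M * rho = \int[P]_w (M * (tilt n w * 1 * (expR (Z n w - phi) * `|Z n w - m| ^+ 3))).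
    by rewrite RintegralZl// E3 /tilted_exp wexp_cst// mul1r.
  have -> : tilted_exp n f + s ^+ 2 / 2 * tilted_exp n f2 =
     \int[P]_w (tilt n w * f (centered n w) * (expR (Z n w - phi) * 1) +
      (tilt n w * f1 (centered n w) * (expR (Z n w - phi) * (Z n w - m)) +
       2^-1 * (tilt n w * f2 (centered n w) * (expR (Z n w - phi) * (Z n w - m) ^+ 2)))).
    rewrite RintegralD//; last by apply: intgD => //; exact: intgZ.
    rewrite RintegralD//; last exact: intgZ.
    by rewrite RintegralZl// E0 E1 E2; field.
  apply: Rint_close.
  - exact: wexp_intg.
  - by apply: intgD => //; apply: intgD => //; exact: intgZ.
  - exact: intgZ.
  move=> w; rewrite tiltS centeredS.
  have -> : M * (tilt n w * 1 * (expR (Z n w - phi) * `|Z n w - m| ^+ 3)) =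
    tilt n w * expR (Z n w - phi) * (M * `|Z n w - m| ^+ 3) by ring.
  apply: le_trans (ler_wpM2l _ (Hf (centered n w) (Z n w - m))); last first.
    by rewrite mulr_ge0// ?expR_ge0.
  rewrite -[X in X * `|_|]ger0_norm ?mulr_ge0 ?expR_ge0// -normrM le_eqVlt; apply/orP; left;
    apply/eqP.
  by congr `|_|; field.
have step2 : `|tilted_exp n (coin s f) - (tilted_exp n f +
  s ^+ 2 / 2 * tilted_exp n f2)| <= M * `|s| ^+ 3.
  rewrite -wexpZ// -wexpD//; last exact: bmeasZ.
  apply: wexp_close => //; first by apply: bmeasD => //; exact: bmeasZ.
  exact: coin_approx.
rewrite mulrDr; apply: le_trans (lerD step1 step2).
by rewrite [X in _ <= _ + X]distrC; apply: le_trans (ler_normD _ _); rewrite subrKA.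
Qed.

(** The last true step is replaced by a coin flip, which is then absorbed into the test function:
    the induction goes on with [coin s f], whose Taylor constant is still [M]. *)
Lemma lindeberg n M f : 0 <= M -> taylor3 M f -> (exists K, forall x, `|f x| <= K) ->
  `|tilted_exp n f - iter n (coin s) f 0| <= n%:R * (M * (rho + `|s| ^+ 3)).
Proof.
move=> M0; elim: n f => [|n IH] f tf bf.
  rewrite mul0r /= /tilted_exp /wexp (_ : (fun w => _) = fun=> f 0).
    by rewrite Rint_cst subrr normr0.
  apply/funext => w; rewrite /tilt /centered /row_sum big_ord0 !mulr0 !subrr.
  by rewrite expR0 mul1r.
rewrite iterSr -natr1 mulrDl mul1r [leRHS]addrC.
apply: le_trans (lerD (lindeberg_step n M0 tf bf) (IH _ (taylor3_coin s tf) _)).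
  by apply: le_trans (ler_normD _ _); rewrite subrKA.
by case: bf => K Kf; exists K; exact: bounded_coin.
Qed.

End Lindeberg.

(** * Cosine expectations and small-ball probabilities at scale sqrt n *)

Section Estimates.
Context d (T : measurableType d) (R : realType) (P : probability T R).
Variables (s C : R).
Hypotheses (s0 : 0 <= s) (C0 : 0 <= C).

(** All that the asymptotics use of a row, with [C] standing for [rho + |s| ^+ 3]. Quantifying over
    [u] and [D] after the threshold on [n] makes the later estimates uniform over the rows. *)
Definition lindeberg_law n (u D : T -> R) := [/\ forall w, 0 <= u w,
  has_int P u 1, measurable_fun setT D &
  forall M f, 0 <= M -> taylor3 M f -> (exists K, forall x, `|f x| <= K) ->
  `|wexp P u D f - iter n (coin s) f 0| <= n%:R * (M * C)].

Lemma measurable_abs_le (a : R) : measurable [set x : R | `|x| <= a].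
Proof.
rewrite (_ : [set x | _] = `[- a, a]%classic); first exact: measurable_itv.
by apply/seteqP; split => x /=; rewrite in_itv/= ler_norml.
Qed.

Lemma bmeas_cos (t : R) : bmeas (fun x => cos (t * x)).
Proof.
split; last by exists 1 => x; exact: cos_max.
by case: (taylor3_cos t) => f1 [f2 []].
Qed.

Lemma sqrtn_ge (A : R) : exists n0, forall n, (n0 <= n)%N ->
  A <= Num.sqrt n%:R /\ 0 < Num.sqrt (n%:R : R).
Proof.
exists (Num.bound (A ^+ 2)).+1 => n ln.
have n0 : 0 < n%:R :> R by rewrite ltr0n; apply: leq_trans ln.
split; last by rewrite sqrtr_gt0.
apply: le_trans (ler_norm _) _; rewrite -sqrtr_sqr ler_sqrt////.
apply: ltW; apply: lt_le_trans (archi_boundP (sqr_ge0 A)) _.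
by rewrite ler_nat; apply: leq_trans ln.
Qed.

(** The coin walk contributes [cos (j * t * s) ^+ n] with [t = theta / r]. The smallness condition
    puts the argument below 1/4, where [abs_cos_le_exp] applies, and [1 <= |j|] removes [j] from the
    exponent. The second term is the Lindeberg error. *)
Lemma cos_bound n u D (theta q j : R) : lindeberg_law n u D -> 0 < theta -> (0 < n)%N ->
  let r := Num.sqrt n%:R in
  1 <= `|j| <= q -> q * theta * s / r <= 1 / 4 ->
  `|wexp P u D (fun x => cos (j * (theta / r) * x))| <=
    expR (- (theta ^+ 2 * s ^+ 2 / 4)) + 2 * (q * theta) ^+ 3 * C / r.
Proof.
move=> [u0 [ui u1] mD LB] th0 n0 r /andP[j1 jq] small.
have r0 : 0 < r by rewrite sqrtr_gt0 ltr0n.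
have r2 : n%:R = r ^+ 2 by rewrite sqr_sqrtr.
have q0 : 0 <= q by lra.
set t := theta / r.
have t0 : 0 < t by rewrite divr_gt0.
have := LB _ _ _ (taylor3_cos (j * t)); rewrite iter_coin_cos mulr0 cos0 mulr1.
rewrite mulr_ge0 ?exprn_ge0// => /(_ isT).
have bc : exists K, forall x, `|cos (j * t * x)| <= K by exists 1 => x; exact: cos_max.
move=> /(_ bc) H.
have E1 : `|cos (j * t * s) ^+ n| <= expR (- (theta ^+ 2 * s ^+ 2 / 4)).
  rewrite normrX; apply: (@le_trans _ _ (expR (- ((j * t * s) ^+ 2 / 4)) ^+ n)).
    apply: lerXn2r; rewrite ?nnegrE ?expR_ge0//; apply: abs_cos_le_exp.
    apply: le_trans _ small; rewrite (normrM (j * t)) (normrM j) (gtr0_norm t0)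
      (ger0_norm s0) /t.
    rewrite (_ : q * theta * s / r = q * (theta / r) * s); last by field; rewrite gt_eqF.
    by rewrite ler_wpM2r// ler_wpM2r// (ltW t0).
  rewrite -expRM_natl ler_expR r2 mulrN lerN2.
  rewrite (_ : r ^+ 2 * _ = j ^+ 2 * (theta ^+ 2 * s ^+ 2 / 4)); last by rewrite /t; field;
    rewrite gt_eqF.
  apply: ler_peMl; first by apply: divr_ge0 => //; apply: mulr_ge0; exact: sqr_ge0.
  by rewrite -[j ^+ 2]real_normK ?num_real// expr_ge1.
have E2 : n%:R * (2 * `|j * t| ^+ 3 * C) <= 2 * (q * theta) ^+ 3 * C / r.
  rewrite normrM (gtr0_norm t0) r2.
  rewrite (_ : r ^+ 2 * _ = 2 * (`|j| * theta) ^+ 3 * C / r); last by rewrite /t; field;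
    rewrite gt_eqF.
  rewrite ler_pM2r ?invr_gt0// ler_wpM2r// ler_wpM2l//.
  by rewrite lerXn2r ?nnegrE ?mulr_ge0 ?(ltW th0)// ler_wpM2r// (ltW th0).
apply: le_trans (lerD E1 (le_trans H E2)).
by apply: le_trans (ler_normD _ _); rewrite addrC subrK.
Qed.

(* Averaging [cos (k t x)] over [k <= m] gives a trigonometric polynomial that is
   at least 1/2 near 0 and whose second moment is about [1/m]. *)
Lemma small_ball_bound n u D (theta : R) m : lindeberg_law n u D ->
  0 < theta -> (0 < n)%N -> (0 < m)%N ->
  let r := Num.sqrt n%:R in
  2 * m%:R * theta * s / r <= 1 / 4 ->
  wexp P u D \1_[set x : R | `|x| <= r / (2 * m%:R * theta)] <=
  4 / m%:R + 4 * (expR (- (theta ^+ 2 * s ^+ 2 / 4)) + 2 * (2 * m%:R * theta) ^+ 3 * C / r).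
Proof.
move=> L th0 n0 m0 r small; set beta := (X in _ + 4 * X).
have r0 : 0 < r by rewrite sqrtr_gt0 ltr0n.
have Lc := cos_bound L th0 n0 _ small; have [u0 [ui u1] mD _] := L.
have mR0 : 0 < m%:R :> R by rewrite ltr0n.
set t := theta / r; have t0 : 0 < t by rewrite divr_gt0.
(* Frequencies start at [k.+1], so that a sum of two of them is never 0; it is at most [2 * m], the
   value of [q] in [Lc]. *)
pose c (k : 'I_m) (x : R) : R := cos (k.+1%:R * t * x).
pose F x := \sum_(k < m) \sum_(l < m) c k x * c l x.
have bc k l : bmeas (fun x => c k x * c l x) by apply: bmeasM; exact: bmeas_cos.
have bF : bmeas F by apply: bmeas_sum => k; exact: bmeas_sum.
have FE x : F x = (\sum_(k < m) c k x) ^+ 2.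
  by rewrite expr2 big_distrlr.
have mA := measurable_abs_le (r / (2 * m%:R * theta)).
(* On this interval all the angles are at most [m * t * |x| <= 1/2], so the [m] cosines are at least
   1/2 and [F] is at least [m ^+ 2 / 4]. *)
have majo x : \1_[set x : R | `|x| <= r / (2 * m%:R * theta)] x <= 4 / m%:R ^+ 2 * F x.
  rewrite indicE FE; case: (boolP (_ \in _)) => [|_]; last first.
    by apply: mulr_ge0; [apply: divr_ge0 => //; exact: sqr_ge0|exact: sqr_ge0].
  rewrite inE /= => xs.
  have ck k : 1 / 2 <= c k x.
    apply: cos_ge_half; rewrite (normrM (_ * t)) (normrM _ t) (gtr0_norm t0) normr_nat.
    apply: (@le_trans _ _ (m%:R * t * (r / (2 * m%:R * theta)))).
      by apply: ler_pM => //; [exact: mulr_ge0 _ (ltW t0)|rewrite ler_wpM2r ?ler_nat//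
        (ltW t0)].
    by rewrite /t le_eqVlt; apply/orP; left; apply/eqP; field; rewrite !gt_eqF.
  have : m%:R / 2 <= \sum_(k < m) c k x.
    rewrite [leLHS](_ : _ = \sum_(k < m) (1 / 2 : R)); first exact: ler_sum.
    by rewrite sumr_const card_ord -[RHS]mulr_natr; field.
  move=> H; rewrite mulrAC ler_pdivlMr ?exprn_gt0// mul1r.
  have : (m%:R / 2) ^+ 2 <= (\sum_(k < m) c k x) ^+ 2.
    by rewrite lerXn2r// nnegrE; [|apply: le_trans H]; rewrite divr_ge0// ltW.
  by rewrite expr_div_n; lra.
(* Product-to-sum formula: the frequency [k - l] vanishes only on the diagonal, and every other
   frequency is handled by [Lc]. *)
have term k l : wexp P u D (fun x => c k x * c l x) <= (k == l)%:R + beta.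
  have -> : wexp P u D (fun x => c k x * c l x) =
    wexp P u D (fun x => 2^-1 * (cos ((k.+1%:R - l.+1%:R) * t * x) + cos ((k.+1%:R +
      l.+1%:R) * t * x))).
    congr wexp; apply/funext => x; rewrite /c.
    by rewrite !mulrBl !mulrDl cosB cosD; field.
  rewrite wexpZ//; last by apply: bmeasD; exact: bmeas_cos.
  rewrite wexpD//; try exact: bmeas_cos.
  have Hp : wexp P u D (fun x => cos ((k.+1%:R + l.+1%:R) * t * x)) <= beta.
    apply: le_trans (ler_norm _) _; apply: Lc; rewrite ger0_norm ?addr_ge0//.
    rewrite mulr_natl mulr2n -2!natrD !ler_nat leq_add ?ltn_ord// andbT.
    by rewrite ler1n addnS.
  have b0 : 0 <= beta.
    by apply: le_trans (Lc 1 _);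
      [exact: normr_ge0|rewrite normr1 lexx/= mulr_natl mulr2n -natrD ler1n addn_gt0 m0].
  have [e|kl] := eqVneq k l.
    subst l; rewrite subrr mul0r.
    under [X in wexp _ _ _ X]eq_fun do rewrite mul0r cos0.
    by rewrite wexp_cst//=; lra.
  have Hm : wexp P u D (fun x => cos ((k.+1%:R - l.+1%:R) * t * x)) <= beta.
    apply: le_trans (ler_norm _) _; apply: Lc; apply/andP; split.
      have [lt|lt|/val_inj e] := ltngtP k l; last by rewrite e eqxx in kl.
        by rewrite distrC -natrB ?ltnS 1?ltnW// ger0_norm// ler1n subSS subn_gt0.
      by rewrite -natrB ?ltnS 1?ltnW// ger0_norm// ler1n subSS subn_gt0.
    apply: le_trans (ler_normB _ _) _; rewrite !ger0_norm// mulr_natl mulr2n.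
    by rewrite lerD// ler_nat.
  by rewrite add0r; lra.
have QF : wexp P u D F <= m%:R + m%:R ^+ 2 * beta.
  rewrite /F wexp_sum//; last by move=> k; exact: bmeas_sum.
  apply: (@le_trans _ _ (\sum_(k < m) (1 + m%:R * beta))); last first.
    rewrite sumr_const card_ord -[leLHS]mulr_natr le_eqVlt; apply/orP; left; apply/eqP; ring.
  apply: ler_sum => k _; rewrite wexp_sum//.
  apply: (@le_trans _ _ (\sum_(l < m) ((k == l)%:R + beta))); first exact: ler_sum.
  rewrite big_split/= sumr_const card_ord -[beta *+ m]mulr_natl lerD2r.
  by rewrite (bigD1 k)//= eqxx big1 ?addr0// => l lk; rewrite eq_sym (negbTE lk).
apply: (@le_trans _ _ (4 / m%:R ^+ 2 * wexp P u D F)).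
  rewrite -wexpZ//; apply: wexp_le => //; first exact: bmeas_indic.
  exact: bmeasZ.
apply: (@le_trans _ _ (4 / m%:R ^+ 2 * (m%:R + m%:R ^+ 2 * beta))).
  by rewrite ler_wpM2l// divr_ge0// sqr_ge0.
by rewrite le_eqVlt; apply/orP; left; apply/eqP; field; rewrite gt_eqF.
Qed.

End Estimates.

(** * Asymptotics of the tilted law *)

Section Asymptotics.
Context d (T : measurableType d) (R : realType) (P : probability T R).
Variables (s C : R).
Hypotheses (s0 : 0 <= s) (C0 : 0 <= C).
Local Notation law := (lindeberg_law P s C).

Lemma expRN_le (x : R) : 0 < x -> expR (- x) <= x^-1.
Proof.
move=> x0; rewrite expRN lef_pV2 ?posrE ?expR_gt0//.
by apply: le_trans (expR_ge1Dx x); rewrite lerDr.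
Qed.

Lemma measurable_le (a : R) : measurable [set x : R | x <= a].
Proof.
rewrite (_ : [set x | _] = `]-oo, a]%classic); first exact: measurable_itv.
by apply/seteqP; split => x /=; rewrite in_itv.
Qed.

Lemma measurable_gt (a : R) : measurable [set x : R | a < x].
Proof.
rewrite (_ : [set x | _] = `]a, +oo[%classic); first exact: measurable_itv.
by apply/seteqP; split => x /=; rewrite in_itv/= andbT.
Qed.

Lemma indic_bool (p : R -> bool) x : \1_[set x : R | p x] x = (p x)%:R :> R.
Proof.
rewrite indicE; congr (_%:R); congr nat_of_bool.
by apply/idP/idP; [move/set_mem|move=> ?; apply/mem_set].
Qed.

(** Each of the three terms of [small_ball_bound] is brought below [eps / 3], by the choice of [m],
    then [theta], then [n]; [eta] depends on [m] and [theta] only. *)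
Lemma wexp_small_ball eps : 0 < s -> 0 < eps -> exists eta n0, 0 < eta /\
  forall n u D, (n0 <= n)%N -> law n u D ->
  wexp P u D \1_[set x : R | `|x| <= eta * Num.sqrt n%:R] <= eps.
Proof.
move=> sp e0; pose m := (Num.bound (12 / eps)).+1.
have m0 : 0 < m%:R :> R by rewrite ltr0n.
have me : 4 / m%:R <= eps / 3.
  rewrite ler_pdivrMr// mulrC -ler_pdivrMr ?divr_gt0//.
  apply: (@le_trans _ _ (12 / eps)); first by rewrite le_eqVlt; apply/orP; left; apply/eqP;
    field; rewrite gt_eqF.
  apply: ltW; apply: lt_le_trans (archi_boundP _) _; first by rewrite divr_ge0// ltW.
  by rewrite ler_nat.
have x0 : 0 < 12 / eps by rewrite divr_gt0.
(* Chosen so that the exponent [theta ^+ 2 * s ^+ 2 / 4] is the square of [1 + 12 / eps], hence at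
   least [12 / eps]. *)
pose theta := 2 / s * (1 + 12 / eps).
have th0 : 0 < theta by rewrite mulr_gt0 ?divr_gt0// ltr_pwDl// ltW.
have te : 4 * expR (- (theta ^+ 2 * s ^+ 2 / 4)) <= eps / 3.
  have -> : theta ^+ 2 * s ^+ 2 / 4 = (1 + 12 / eps) ^+ 2.
    by rewrite /theta; field; rewrite !gt_eqF.
  rewrite mulrC -ler_pdivlMr//; apply: (@le_trans _ _ (expR (- (12 / eps)))).
    by rewrite ler_expR lerN2; nra.
  apply: le_trans (expRN_le x0) _; rewrite le_eqVlt; apply/orP; left; apply/eqP.
  by field; rewrite gt_eqF.
have [n0 H] := sqrtn_ge (Num.max (24 * (2 * m%:R * theta) ^+ 3 * C / eps)
  (8 * m%:R * theta * s)).
exists (2 * m%:R * theta)^-1, n0; split; first by rewrite invr_gt0 mulr_gt0// mulr_gt0.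
move=> n u D /H [+ r0] L; rewrite ge_max => /andP[r1 r2].
have n_gt0 : (0 < n)%N by rewrite -(ltr0n R) -sqrtr_gt0.
have := small_ball_bound s0 C0 L th0 n_gt0 (ltn0Sn _ : 0 < m)%N.
rewrite [_^-1 * _]mulrC => /(_ _)/le_trans; apply.
  by rewrite ler_pdivrMr//; lra.
have : 2 * (2 * m%:R * theta) ^+ 3 * C / Num.sqrt n%:R <= eps / 12.
  move: r1; rewrite ler_pdivrMr// ler_pdivrMr//; set z := _ ^+ 3; lra.
rewrite -/m; lra.
Qed.

(** The slope [3 / y] makes [step] fall from 1 to 0 across [[0, y]], so smoothing changes the two
    half-line indicators only where [|x| <= y]. The form [1 + (-1) * i0] fits [wexpD] and
    [wexpZ]. *)
Lemma step_sandwich (x y : R) : 0 < y ->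
  let i0 : R -> R := \1_[set x : R | x <= 0] in
  let ib : R -> R := \1_[set x : R | `|x| <= y] in
  let a := 3 / y in
  [/\ i0 x <= step (a * x + 0), step (a * x + 0) <= i0 x + ib x,
      1 + (-1) * i0 x <= step (- a * x + 0) & step (- a * x + 0) <= 1 + (-1) * i0 x + ib x].
Proof.
move=> y0 i0 ib a; have a0 : 0 < a by rewrite divr_gt0.
have fy z : y <= z -> step (a * z) = 0.
  move=> yz; apply: step_ge3; rewrite /a mulrAC ler_pdivlMr//; lra.
have f0 z : z <= 0 -> step (a * z) = 1.
  by move=> z0; apply: step_le0; rewrite pmulr_rle0.
have := step_itv (a * x); have := step_itv (a * - x).
have -> : - a * x = a * - x by ring.
rewrite !addr0 /i0 /ib !indic_bool.
have [xn|xp] := leP x 0.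
  rewrite (f0 _ xn) ler0_norm//=; have [xy|xy] := leP (- x) y; last rewrite (fy _ (ltW xy));
    by move=> /andP[H H0] _; split => /=; lra.
have xn : - x <= 0 by lra.
rewrite (f0 _ xn) gtr0_norm//=; have [xy|xy] := leP x y; last rewrite (fy _ (ltW xy));
  by move=> _ /andP[H H0]; split => /=; lra.
Qed.

(* [f] and its reflection have the same coin-walk expectation, so the tilted masses of
   the two half-lines differ by at most a small-ball probability and a Lindeberg error. *)
Lemma wexp_le0_half eps : 0 < s -> 0 < eps -> exists n0, forall n u D, (n0 <= n)%N ->
  law n u D -> `|wexp P u D \1_[set x : R | x <= 0] - 1 / 2| <= eps.
Proof.
move=> sp e0; have [eta [n1 [eta0 Hb]]] := wexp_small_ball sp e0.
(* With slope [3 / (eta * r)] the Lindeberg error is [36 * C / (eta ^+ 3 * r)]; the threshold makes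
   it at most [eps / 2]. *)
have [n2 H2] := sqrtn_ge (72 * C / eta ^+ 3 / eps).
exists (maxn n1 n2) => n u D; rewrite geq_max => /andP[/Hb{}Hb /H2[r1 r0]] L.
have {Hb} := Hb _ _ L; set r := Num.sqrt _ in r1 r0 *; set b := wexp _ _ _ _ => Hb.
have [u0 [ui u1] mD LB] := L.
have y0 : 0 < eta * r by rewrite mulr_gt0.
set y := eta * r in y0 b Hb *; pose a := 3 / y.
have a0 : 0 < a by rewrite divr_gt0.
have r2 : n%:R = r ^+ 2 by rewrite sqr_sqrtr.
pose f x := step (a * x + 0); pose g x := step (- a * x + 0).
have gE : g = fun x => f (- x) by apply/funext => x; rewrite /f /g mulrN mulNr.
have tf : taylor3 (4 / 3 * `|a| ^+ 3) f := taylor3_affine a 0 (@taylor3_step R).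
have tg : taylor3 (4 / 3 * `|a| ^+ 3) g.
  by rewrite -(normrN a); exact: (taylor3_affine (- a) 0 (@taylor3_step R)).
have s1 x : `|@step R x| <= 1.
  by have /andP[? ?] := step_itv x; rewrite ger0_norm.
have bf : bmeas f by case: (tf) => ? [? []]; split => //; exists 1 => x; exact: s1.
have bg : bmeas g by case: (tg) => ? [? []]; split => //; exists 1 => x; exact: s1.
have M0 : 0 <= 4 / 3 * `|a| ^+ 3 by rewrite mulr_ge0// exprn_ge0.
have := LB _ _ M0 tf bf.2; have := LB _ _ M0 tg bg.2.
have -> : iter n (coin s) g 0 = iter n (coin s) f 0 by rewrite gE iter_coin_opp oppr0.
set I := iter _ _ _ _; set A := wexp P u D f.
set B := wexp P u D g.
have err : n%:R * (4 / 3 * `|a| ^+ 3 * C) <= eps / 2.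
  rewrite gtr0_norm// r2 (_ : r ^+ 2 * _ = 36 * C / eta ^+ 3 / r); last first.
    by rewrite /a /y; field; rewrite !gt_eqF.
  rewrite ler_pdivrMr//; move: r1; rewrite ler_pdivrMr//; set z := _ / eta ^+ 3.
  rewrite (_ : 36 * C / eta ^+ 3 = z / 2); last by rewrite /z; field; rewrite gt_eqF ?exprn_gt0.
  lra.
move=> HB HA.
pose i0 : R -> R := \1_[set x : R | x <= 0]; pose ib : R -> R := \1_[set x : R | `|x| <= y].
have bi0 : bmeas i0 by apply: bmeas_indic; exact: measurable_le.
have bib : bmeas ib by apply: bmeas_indic; exact: measurable_abs_le.
have Hx x := step_sandwich x y0.
have b1 : bmeas (fun x => 1 + (-1) * i0 x) by apply: bmeasD; [exact: bmeas_cst|exact: bmeasZ].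
have E1 : wexp P u D i0 <= A by apply: wexp_le => // x; case: (Hx x).
have E2 : A <= wexp P u D i0 + b.
  by rewrite -wexpD//; apply: wexp_le => //; [exact: bmeasD|move=> x; case: (Hx x)].
have W1 : wexp P u D (fun x => 1 + (-1) * i0 x) = 1 - wexp P u D i0.
  by rewrite wexpD ?wexpZ ?wexp_cst ?mulN1r//; [exact: bmeas_cst|exact: bmeasZ].
have E3 : 1 - wexp P u D i0 <= B.
  by rewrite -W1; apply: wexp_le => // x; case: (Hx x).
have E4 : B <= 1 - wexp P u D i0 + b.
  by rewrite -W1 -wexpD//; apply: wexp_le => //; [exact: bmeasD|move=> x; case: (Hx x)].
(* [A] and [B] are both within [eps / 2] of [I]. The masses of the half-lines therefore differ by at
   most [eps + b <= 2 * eps], and they add up to 1. *)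
move: HA HB; rewrite !ler_norml -/i0 => /andP[? ?] /andP[? ?]; apply/andP; split; lra.
Qed.

(** A coin step moves [g (a * x)] by a second-order amount in [a * s]; with [a] of order [1 / n],
    the total over [n] steps is O(1/n). *)
Lemma coin_scaled_close (g : R -> R) M K a x : taylor3 M g -> (forall x, `|g x| <= K) ->
  `|coin s (fun x => g (a * x)) x - g (a * x)| <=
    (a * s) ^+ 2 / 2 * (4 * K + 2 * M) + M * `|a * s| ^+ 3.
Proof.
move=> [g1 [g2 [_ _ _ Hg]]] Kg; have [_ K2] := taylor3_bounded Kg Hg.
have := coin_approx (a * s) Hg (a * x).
rewrite /coin (mulrDr a x s) (mulrDr a x (- s)) mulrN; set z := _ / 2 => H.
apply: (@le_trans _ _ (`|(a * s) ^+ 2 / 2 * g2 (a * x)| + `|z - (g (a * x) +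
  (a * s) ^+ 2 / 2 * g2 (a * x))|)).
  by apply: le_trans (ler_normD _ _); rewrite le_eqVlt; apply/orP; left; apply/eqP;
    congr `|_|; ring.
apply: lerD => //; rewrite normrM ger0_norm; last by rewrite divr_ge0 ?sqr_ge0.
by rewrite ler_wpM2l// divr_ge0 ?sqr_ge0.
Qed.

(** A weak law of large numbers by Lindeberg replacement at scale [n]: both the replacement error
    and the drift of the coin walk are O(1/n) for the test function [step (a * x)], whose value at 0
    is 1. *)
Lemma wexp_upper_tail kappa K eps : 0 < kappa -> 0 < eps ->
  exists n0, forall n u D, (n0 <= n)%N ->
  law n u D -> wexp P u D \1_[set x : R | kappa * n%:R - K < x] <= eps.
Proof.
(* With this [b] the test function vanishes from [kappa * n / 2] on; the second summand in the
   threshold on [n] puts [kappa * n - K] beyond that point. *)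
move=> k0 e0; pose b := 6 / kappa.
have b0 : 0 < b by rewrite divr_gt0.
(* [V / n] bounds the total error, the terms in [1 / n ^+ 2] being estimated by [1 / n]. *)
pose V := (b * s) ^+ 2 / 2 * (4 + 2 * (4 / 3)) + 4 / 3 * (b * s) ^+ 3 + 4 / 3 * b ^+ 3 * C.
have V0 : 0 <= V.
  have := mulr_ge0 (exprn_ge0 3 (ltW b0)) C0.
  have := exprn_ge0 3 (mulr_ge0 (ltW b0) s0); have := sqr_ge0 (b * s).
  rewrite /V; lra.
exists (Num.bound (V / eps + 2 * `|K| / kappa)).+1 => n u D nn [u0 [ui u1] mD LB].
have n1 : 1 <= n%:R :> R by rewrite ler1n; apply: leq_trans nn.
have n0 : 0 < n%:R :> R by apply: lt_le_trans n1.
have {nn} nV : V / eps + 2 * `|K| / kappa <= n%:R.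
  apply: ltW; apply: lt_le_trans (archi_boundP _) _; last by rewrite ler_nat ltnW.
  by apply: addr_ge0; apply: divr_ge0; rewrite ?mulr_ge0 ?(ltW e0) ?(ltW k0).
have nV1 : V / eps <= n%:R.
  by apply: le_trans nV; rewrite lerDl divr_ge0 ?mulr_ge0 ?(ltW k0).
have nV2 : 2 * `|K| / kappa <= n%:R.
  by apply: le_trans nV; rewrite lerDr divr_ge0 ?(ltW e0).
pose a := b / n%:R; have a0 : 0 < a by rewrite divr_gt0.
pose f x := step (a * x).
have tf : taylor3 (4 / 3 * `|a| ^+ 3) f.
  have := taylor3_affine a 0 (@taylor3_step R).
  by congr (taylor3 _ _); apply/funext => x; rewrite addr0.
have s1 x : `|@step R x| <= 1.
  by have /andP[? ?] := step_itv x; rewrite ger0_norm.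
have bf : bmeas f by case: (tf) => ? [? []]; split => //; exists 1 => x; exact: s1.
have M0 : 0 <= 4 / 3 * `|a| ^+ 3 by rewrite mulr_ge0// exprn_ge0.
have H1 := LB _ _ M0 tf bf.2.
have H2 := iter_coin_close (fun x => coin_scaled_close a x (@taylor3_step R) s1) n 0.
rewrite mulr0 (step_le0 (lexx 0)) in H2.
have as0 : 0 <= a * s by rewrite mulr_ge0 ?(ltW a0).
have err : n%:R * (4 / 3 * `|a| ^+ 3 * C) +
    n%:R * ((a * s) ^+ 2 / 2 * (4 * 1 + 2 * (4 / 3)) + 4 / 3 * `|a * s| ^+ 3) <= eps.
  rewrite (gtr0_norm a0) (ger0_norm as0).
  apply: (@le_trans _ _ (V / n%:R)); last first.
    by rewrite ler_pdivrMr// mulrC -ler_pdivrMr.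
  pose v := n%:R^-1 : R.
  have v0 : 0 < v by rewrite invr_gt0.
  have v1 : v <= 1 by rewrite invf_le1.
  have -> : n%:R * (4 / 3 * a ^+ 3 * C) = (4 / 3 * b ^+ 3 * C) * v * v.
    by rewrite /a /v; field; rewrite gt_eqF.
  have -> : n%:R * ((a * s) ^+ 2 / 2 * (4 * 1 + 2 * (4 / 3)) + 4 / 3 * (a * s) ^+ 3) =
    (b * s) ^+ 2 / 2 * (4 + 2 * (4 / 3)) * v + 4 / 3 * (b * s) ^+ 3 * v * v.
    by rewrite /a /v; field; rewrite gt_eqF.
  have p1 : 4 / 3 * b ^+ 3 * C * v * v <= 4 / 3 * b ^+ 3 * C * v.
    apply: ler_piMr v1; apply: mulr_ge0 (ltW v0); apply: mulr_ge0 C0.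
    by apply: mulr_ge0 => //; exact: exprn_ge0 (ltW b0).
  have p2 : 4 / 3 * (b * s) ^+ 3 * v * v <= 4 / 3 * (b * s) ^+ 3 * v.
    apply: ler_piMr v1; apply: mulr_ge0 (ltW v0).
    by apply: mulr_ge0 => //; apply: exprn_ge0; exact: mulr_ge0 (ltW b0) s0.
  rewrite /V -/v !mulrDl; lra.
have bi : bmeas (\1_[set x : R | kappa * n%:R - K < x] : R -> R).
  by apply: bmeas_indic; exact: measurable_gt.
apply: (@le_trans _ _ (wexp P u D (fun x => 1 + (-1) * f x))).
  apply: wexp_le => //; first by apply: bmeasD; [exact: bmeas_cst|exact: bmeasZ].
  move=> x; rewrite indic_bool; have /andP[? ?] := step_itv (a * x).
  have [xk|xk] := ltP (kappa * n%:R - K) x; last by rewrite /= /f; lra.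
  rewrite /= /f step_ge3; first lra.
  rewrite /a /b mulrAC ler_pdivlMr// mulrAC ler_pdivlMr//.
  move: nV2; rewrite ler_pdivrMr//; have := ler_norm K; lra.
rewrite wexpD ?wexpZ ?wexp_cst ?mulN1r//; [|exact: bmeas_cst|exact: bmeasZ].
move: H1 H2; rewrite !ler_norml => /andP[? ?] /andP[? ?]; lra.
Qed.

(** The two facts needed about [L_i], which is [x - kappa * n] here: the mass of the negative
    half-line, and the escape from bounded sets. *)
Definition near_limit kappa p eps n (u D : T -> R) :=
  `|wexp P u D \1_[set x : R | x <= kappa * n%:R] - p| <= eps /\
  wexp P u D (fun x => expR (- `|x - kappa * n%:R|)) <= eps.

Lemma bmeas_expRN_abs (a : R) : bmeas (fun x : R => expR (- `|x - a|)).
Proof.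
split; last by exists 1 => x; rewrite ger0_norm ?expR_ge0// -expR0 ler_expR oppr_le0.
apply: measurableT_comp; first exact: measurable_expR.
apply: measurableT_comp => //; apply: measurableT_comp; first exact: normr_measurable.
exact: measurable_funB.
Qed.

(** Outside the window of radius [eps^-1] the integrand is at most [expR (- eps^-1) <= eps]. *)
Lemma expRN_abs_bound kappa eps n u D : law n u D -> 0 < eps ->
  wexp P u D (fun x => expR (- `|x - kappa * n%:R|)) <=
  eps + wexp P u D \1_[set x : R | `|x - kappa * n%:R| <= eps^-1].
Proof.
move=> [u0 [ui u1] mD _] e0.
have bi : bmeas (\1_[set x : R | `|x - kappa * n%:R| <= eps^-1] : R -> R).
  apply: bmeas_indic.
  rewrite (_ : [set x | _] = `[kappa * n%:R - eps^-1, kappa * n%:R + eps^-1]%classic).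
    exact: measurable_itv.
  by apply/seteqP; split => x /=; rewrite in_itv/= ler_distl.
rewrite -[X in X + _](wexp_cst D ui u1) -wexpD//; last exact: bmeas_cst.
apply: wexp_le => //; [exact: bmeas_expRN_abs|by apply: bmeasD => //; exact: bmeas_cst|].
move=> x; rewrite indic_bool.
have [xe|xe] /= := leP `|x - kappa * n%:R| eps^-1.
  by apply: (@le_trans _ _ 1); [rewrite -expR0 ler_expR oppr_le0|rewrite lerDr ltW].
rewrite addr0; apply: (@le_trans _ _ (expR (- eps^-1))).
  by rewrite ler_expR lerN2 ltW.
by rewrite -[leRHS]invrK expRN_le// invr_gt0.
Qed.

(** The centered walk stays far below [kappa * n], so both the complement of the half-line and the
    window around [kappa * n] lie in upper tails. *)
Lemma near_limit_super kappa eps : 0 < kappa -> 0 < eps ->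
  exists n0, forall n u D, (n0 <= n)%N -> law n u D -> near_limit kappa 1 eps n u D.
Proof.
move=> k0 e0; have e20 : 0 < eps / 2 by rewrite divr_gt0.
have [n1 H1] := wexp_upper_tail 0 k0 e0.
(* The extra 1 places the closed window inside the open tail. *)
have [n2 H2] := wexp_upper_tail ((eps / 2)^-1 + 1) k0 e20.
exists (maxn n1 n2) => n u D; rewrite geq_max => /andP[/H1{}H1 /H2{}H2] L.
have {}H1 := H1 _ _ L; have {}H2 := H2 _ _ L.
have B := expRN_abs_bound kappa L e20; have [u0 [ui u1] mD _] := L.
split; last first.
  rewrite (splitr eps); apply: le_trans B _; rewrite lerD2l; apply: le_trans H2.
  apply: wexp_le => //; [|apply: bmeas_indic; exact: measurable_gt|].
    apply: bmeas_indic.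
    rewrite (_ : [set x | _] = `[kappa * n%:R - (eps / 2)^-1, kappa * n%:R +
      (eps / 2)^-1]%classic).
      exact: measurable_itv.
    by apply/seteqP; split => x /=; rewrite in_itv/= ler_distl.
  move=> x; rewrite !indic_bool ler_nat.
  case: (boolP (_ <= _)) => //; rewrite ler_distl => /andP[x1 _].
  by rewrite (_ : _ < x)//; lra.
move: H1; rewrite subr0.
have -> : (\1_[set x : R | kappa * n%:R < x] : R -> R) =
    fun x => 1 + (-1) * \1_[set x : R | x <= kappa * n%:R] x.
  by apply/funext => x; rewrite !indic_bool; case: leP => /=;
    rewrite ?mulr1 ?mulr0 ?subrr ?addr0.
have bi : bmeas (\1_[set x : R | x <= kappa * n%:R] : R -> R) by apply: bmeas_indic;
  exact: measurable_le.
rewrite wexpD ?wexpZ ?wexp_cst ?mulN1r//; [|exact: bmeas_cst|exact: bmeasZ].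
move=> H1; rewrite distrC ger0_norm// subr_ge0 -[leRHS](wexp_cst D ui u1).
apply: wexp_le => //; first exact: bmeas_cst.
Qed.

(** The threshold is now the tilted mean itself: symmetry gives the mass 1/2, and a window of fixed
    radius ends up inside the small ball of radius [eta * Num.sqrt n%:R]. *)
Lemma near_limit_crit eps : 0 < s -> 0 < eps ->
  exists n0, forall n u D, (n0 <= n)%N -> law n u D -> near_limit 0 (1 / 2) eps n u D.
Proof.
move=> sp e0; have e20 : 0 < eps / 2 by rewrite divr_gt0.
have [n1 H1] := wexp_le0_half sp e0.
have [eta [n2 [eta0 H2]]] := wexp_small_ball sp e20.
have [n3 H3] := sqrtn_ge ((eps / 2)^-1 / eta).
exists (maxn n1 (maxn n2 n3)) => n u D;
  rewrite !geq_max => /and3P[/H1{}H1 /H2{}H2 /H3[r1 r0]] L.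
have {}H1 := H1 _ _ L; have {}H2 := H2 _ _ L.
have B := expRN_abs_bound 0 L e20; have [u0 [ui u1] mD _] := L.
split; first by rewrite mul0r.
rewrite [leRHS](splitr eps); apply: le_trans B _; rewrite lerD2l; apply: le_trans H2.
rewrite mul0r; under eq_set do rewrite subr0.
apply: wexp_le => //; [apply: bmeas_indic; exact: measurable_abs_le..|].
move=> x; rewrite !indic_bool.
have [x1|//] := leP `|x| ((eps / 2)^-1).
suff -> : `|x| <= eta * Num.sqrt n%:R by [].
by apply: le_trans x1 _; rewrite -ler_pdivrMl// mulrC.
Qed.


End Asymptotics.

(** * Truncated second moment *)

Section SecondMoment.
Context d (T : measurableType d) (R : realType) (P : probability T R).
Local Notation intg f := (P.-integrable setT (EFin \o f)).

Definition cut (v : R) : R := expR v * (v <= 0)%R%:R.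

Lemma cut_itv v : 0 <= cut v <= 1.
Proof.
rewrite /cut; case: (leP v 0) => v0 /=; last by rewrite mulr0 lexx ler01.
rewrite mulr1.
by rewrite expR_ge0 -expR0 ler_expR v0.
Qed.

Lemma measurable_le0 : measurable_fun setT (fun v : R => (v <= 0)%R%:R : R).
Proof.
rewrite (_ : (fun v => _) = \1_[set x : R | x <= 0]); first by apply: measurable_indic;
  exact: measurable_le.
by apply/funext => v; rewrite indic_bool.
Qed.

Lemma measurable_cut : measurable_fun setT cut.
Proof. by apply: measurable_funM; [exact: measurable_expR|exact: measurable_le0]. Qed.

Lemma intg_bounded (f : T -> R) K : measurable_fun setT f -> (forall w, `|f w| <= K) -> intg f.
Proof. by move=> mf fK; apply: (intg_dom mf fK); exact: intg_cst. Qed.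

(** Cross terms vanish, the variables being centered and pairwise independent. *)
Lemma sum_sqr_indep (N : nat) (W : 'I_N -> T -> R) K v :
  (forall i, measurable_fun setT (W i)) -> (forall i w, `|W i w| <= K) ->
  (forall i, \int[P]_w W i w = 0) -> (forall i, \int[P]_w (W i w ^+ 2) <= v) ->
  (forall i k, i != k -> independent2 P (W i) (W k)) ->
  \int[P]_w ((\sum_i W i w) ^+ 2) <= N%:R * v.
Proof.
move=> mW bW W0 Wv ind.
have iW i : intg (W i) by exact: intg_bounded (mW i) (bW i).
have iWW i k : intg (fun w => W i w * W k w).
  apply: (@intg_bounded _ (K * K)); first exact: measurable_funM.
  by move=> w; rewrite normrM; apply: ler_pM.
under eq_Rintegral do rewrite expr2 big_distrlr/=.
rewrite Rint_sum => [|i]; last by apply: intg_sum => k; exact: iWW.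
apply: (@le_trans _ _ (\sum_(i < N) v)); last by rewrite sumr_const card_ord mulr_natl.
apply: ler_sum => i _; rewrite Rint_sum// (bigD1 i)//= big1 ?addr0.
  by rewrite (le_trans _ (Wv i)).
move=> k ki; have ik : i != k by rewrite eq_sym.
by have [_ ->] := expectation_indep (ind i k ik) (iW i) (iW k); rewrite W0 mul0r.
Qed.

(** [V i] is the [L_i] of a row and [b] is e^(-cn). The event forces either a row with [V i > 0] or
    a deviation of the truncated sum from its mean by [eps / 2]; Markov bounds the first, Chebyshev
    the second. *)
Lemma concentration (N : nat) (V : 'I_N -> T -> R) (b p delta eps : R) :
  0 < eps -> 0 < b -> 0 <= p <= 1 -> 0 <= delta <= 1 -> 3 * delta <= eps / 2 ->
  (forall i, measurable_fun setT (V i)) ->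
  (forall i k, i != k -> independent2 P (V i) (V k)) ->
  (forall i, `|\int[P]_w cut (V i w) - b * p| <= b * delta) ->
  (forall i, \int[P]_w (expR (V i w) * expR (- `|V i w|)) <= b * delta) ->
  `|N%:R * b - 1| <= delta ->
  (P [set w | (eps < `|\sum_(i < N) expR (V i w) - p|)%R] <=
    (2 * delta + 8 * delta / eps ^+ 2)%R%:E)%E.
Proof.
move=> e0 b0 /andP[p0 p1] /andP[d0 d1] de mV indV H1 H2 Nb.
have Nb2 : N%:R * b <= 2 by move: Nb; rewrite ler_norml => /andP[_]; lra.
pose mu i := \int[P]_w cut (V i w); pose W i w := cut (V i w) - mu i.
have mcut i : measurable_fun setT (fun w => cut (V i w)).
  by apply: measurableT_comp; [exact: measurable_cut|].
have icut i : intg (fun w => cut (V i w)).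
  apply: (@intg_bounded _ 1) => // w.
  by have /andP[? ?] := cut_itv (V i w); rewrite ger0_norm.
(* [G] equals 1 where [V i > 0] and [cut (V i) ^+ 2] elsewhere, so its mean controls both the number
   of discarded rows and the truncated second moment. *)
pose G i w := expR (V i w) * expR (- `|V i w|).
have G0 i w : 0 <= G i w by rewrite mulr_ge0 ?expR_ge0.
have mG i : measurable_fun setT (G i).
  apply: measurable_funM; first by apply: measurableT_comp; [exact: measurable_expR|].
  apply: measurableT_comp; first exact: measurable_expR.
  by apply: measurableT_comp => //; apply: measurableT_comp => //; exact: normr_measurable.
have G1 i w : `|G i w| <= 1.
  by rewrite ger0_norm// /G -expRD -expR0 ler_expR subr_le0 ler_norm.
have iG i : intg (G i) by exact: intg_bounded (mG i) (G1 i).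
have mu01 i : 0 <= mu i <= 1.
  rewrite /mu Rintegral_ge0 => [|w _]; last by case/andP: (cut_itv (V i w)).
  rewrite -[leRHS](Rint_cst P); apply: le_Rint => //; first exact: intg_cst.
  by move=> w; case/andP: (cut_itv (V i w)).
have W1 i w : `|W i w| <= 1.
  rewrite /W ler_norml; have /andP[? ?] := mu01 i; have /andP[? ?] := cut_itv (V i w).
  by apply/andP; split; lra.
have mW i : measurable_fun setT (W i) by exact: measurable_funB.
have iW2 i : intg (fun w => W i w ^+ 2).
  apply: (@intg_bounded _ 1); first exact: measurable_funX.
  by move=> w; rewrite normrX exprn_ile1.
have W0 i : \int[P]_w W i w = 0.
  by rewrite RintegralB//; [rewrite Rint_cst subrr|exact: intg_cst].
have W2 i : \int[P]_w (W i w ^+ 2) <= b * delta.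
  apply: le_trans (H2 i).
  have -> : \int[P]_w (W i w ^+ 2) =
    \int[P]_w (cut (V i w) ^+ 2 - (2 * mu i * cut (V i w) - mu i ^+ 2)).
    by apply: eq_Rintegral => w _; rewrite /W; ring.
  have ic2 : intg (fun w => cut (V i w) ^+ 2).
    apply: (@intg_bounded _ 1); first exact: measurable_funX.
    by move=> w; have /andP[? ?] := cut_itv (V i w); rewrite normrX exprn_ile1// ger0_norm.
  rewrite RintegralB//; last by apply: intgB; [exact: intgZ|exact: intg_cst].
  rewrite RintegralB//; [|exact: intgZ|exact: intg_cst].
  rewrite RintegralZl// Rint_cst -/(mu i).
  apply: (@le_trans _ _ (\int[P]_w (cut (V i w) ^+ 2))).
    by have := sqr_ge0 (mu i); lra.
  apply: le_Rint => //; first exact: iG.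
  move=> w; rewrite /cut.
  have [v0|v0] := leP (V i w) 0; last by rewrite mulr0 expr0n/= mulr_ge0 ?expR_ge0.
  by rewrite mulr1 ler0_norm// opprK expr2.
have SW : \int[P]_w ((\sum_i W i w) ^+ 2) <= N%:R * (b * delta).
  apply: (@sum_sqr_indep _ _ 1) => // i k ik.
  apply: (@independent2_comp _ _ _ P (V i) (V k) (fun v => cut v - mu i)
    (fun v => cut v - mu k)) => //.
  - by apply: measurable_funB => //; exact: measurable_cut.
  - by apply: measurable_funB => //; exact: measurable_cut.
  - exact: indV.
have iSW : intg (fun w => (\sum_i W i w) ^+ 2).
  apply: (@intg_bounded _ (N%:R ^+ 2)).
    by apply: measurable_funX; exact: measurable_sum.
  move=> w; rewrite normrX lerXn2r// ?nnegrE//.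
  apply: le_trans (ler_norm_sum _ _ _) _.
  by apply: (@le_trans _ _ (\sum_(i < N) 1)); [by apply: ler_sum => j _;
    exact: W1|rewrite sumr_const card_ord].
(* Each mean is replaced by [b * p], at a total cost of [2 * delta], and then [N * b] by 1, at a
   cost of [delta]. *)
have Smu : `|\sum_i mu i - p| <= 3 * delta.
  have E : \sum_i mu i - p = \sum_i (mu i - b * p) + p * (N%:R * b - 1).
    by rewrite sumrB sumr_const card_ord -[(b * p) *+ N]mulr_natl; ring.
  rewrite E; apply: le_trans (ler_normD _ _) _.
  have A1 : `|\sum_i (mu i - b * p)| <= N%:R * b * delta.
    apply: le_trans (ler_norm_sum _ _ _) _.
    apply: (@le_trans _ _ (\sum_(i < N) (b * delta))); first by apply: ler_sum => j _;
      exact: H1.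
    by rewrite sumr_const card_ord -[(b * delta) *+ N]mulr_natl mulrA.
  have A2 : `|p * (N%:R * b - 1)| <= delta.
    by rewrite normrM (ger0_norm p0); apply: le_trans Nb; rewrite ler_piMl.
  have A3 : N%:R * b * delta <= 2 * delta by rewrite ler_wpM2r.
  lra.
pose A : set T := [set w | eps < `|\sum_(i < N) expR (V i w) - p|].
rewrite -/A.
have mA : measurable A.
  rewrite (_ : A = (fun w => `|\sum_(i < N) expR (V i w) - p|) @^-1` [set x | eps < x])//.
  rewrite -[X in measurable X]setTI.
  have mf : measurable_fun setT (fun w => `|\sum_(i < N) expR (V i w) - p|).
    apply: measurableT_comp; first exact: normr_measurable.
    apply: measurable_funB => //; apply: measurable_sum => j.
    by apply: measurableT_comp; [exact: measurable_expR|].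
  by apply: mf => //; exact: measurable_gt.
have iA : intg (\1_A : T -> R) by exact: integrable_indic.
have PA : P A = (\int[P]_w \1_A w)%:E.
  by rewrite /Rintegral integral_indic// setIT fineK// fin_num_measure.
rewrite PA lee_fin.
have iS : intg (fun w => \sum_i G i w) by exact: intg_sum.
(* The indicator of the event is bounded pointwise: the first sum is at least 1 if a row is
   discarded, the second term is at least 1 otherwise. *)
apply: (@le_trans _ _ (\int[P]_w (\sum_i G i w + 4 / eps ^+ 2 * (\sum_i W i w) ^+ 2))).
  apply: le_Rint => //; first by apply: intgD => //; exact: intgZ.
  move=> w; rewrite indicE.
  have S0 : 0 <= \sum_i G i w by exact: sumr_ge0.
  have Q0 : 0 <= 4 / eps ^+ 2 * (\sum_i W i w) ^+ 2.
    by rewrite mulr_ge0 ?sqr_ge0// divr_ge0// sqr_ge0.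
  case: (boolP (w \in A)) => [|_]; last exact: addr_ge0.
  rewrite inE /A /= => Aw.
  have [/existsP[i Vi]|] := boolP [exists i, 0 < V i w].
    apply: (@le_trans _ _ (\sum_i G i w)); last by rewrite lerDl.
    rewrite (bigD1 i)//= -[leLHS]addr0 lerD ?sumr_ge0//.
    by rewrite /G gtr0_norm// -expRD subrr expR0.
  rewrite negb_exists => /forallP Vn.
  apply: (@le_trans _ _ (4 / eps ^+ 2 * (\sum_i W i w) ^+ 2)); last by rewrite lerDr.
  have E : \sum_i W i w = (\sum_i expR (V i w) - p) - (\sum_i mu i - p).
    rewrite /W sumrB; rewrite (eq_bigr (fun i => expR (V i w))); first by ring.
    by move=> i _; rewrite /cut leNgt Vn mulr1.
  have H : eps / 2 <= `|\sum_i W i w|.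
    rewrite E; apply: le_trans (lerB_normD _ _); rewrite normrN.
    by move: Aw Smu de; lra.
  rewrite -[(\sum_i W i w) ^+ 2]real_normK ?num_real// mulrAC ler_pdivlMr ?exprn_gt0// mul1r.
  have : (eps / 2) ^+ 2 <= `|\sum_i W i w| ^+ 2.
    by rewrite lerXn2r// nnegrE divr_ge0// ltW.
  by rewrite expr_div_n; lra.
rewrite RintegralD//; last exact: intgZ.
rewrite RintegralZl// Rint_sum//; apply: lerD.
  apply: (@le_trans _ _ (\sum_(i < N) (b * delta))); first by apply: ler_sum => i _; exact: H2.
  by rewrite sumr_const card_ord -[(b * delta) *+ N]mulr_natl mulrA ler_wpM2r.
apply: (@le_trans _ _ (4 / eps ^+ 2 * (2 * delta))); last by lra.
rewrite ler_wpM2l//; first by rewrite divr_ge0// sqr_ge0.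
by apply: le_trans SW _; rewrite mulrA ler_wpM2r.
Qed.

End SecondMoment.

(** * Moments of the tilted variable *)

Section Moments.
Context d (T : measurableType d) (R : realType) (P : probability T R).
Variable X : {RV P >-> R}.
Hypothesis fin_mgf : forall t : R, 0 <= t -> log_mgf P X t \is a fin_num.
Local Notation intg f := (P.-integrable setT (EFin \o f)).

Definition mgf (t : R) : R := \int[P]_w expR (X w * t).
Definition mgf' : R := \int[P]_w (X w * expR (X w)).

Lemma mmt_gen_funE t : ('M_P X t = \int[P]_w (expR (X w * t))%:E)%E.
Proof. by rewrite /mmt_gen_fun unlock. Qed.

Lemma measurable_RV : measurable_fun setT X.
Proof. exact: measurable_funP. Qed.

Lemma measurable_expRX (t : R) : measurable_fun setT (fun w => expR (X w * t)).
Proof.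
apply: measurableT_comp; first exact: measurable_expR.
by apply: measurable_funM => //; exact: measurable_RV.
Qed.

(** Finiteness of the logarithm excludes an infinite expectation as well as a zero one. *)
Lemma mgf_intg t : 0 <= t -> intg (fun w => expR (X w * t)) /\ 0 < mgf t.
Proof.
move=> /fin_mgf; rewrite /log_mgf mmt_gen_funE => H.
have I0 : (0 <= \int[P]_w (expR (X w * t))%:E)%E.
  by apply: integral_ge0 => w _; rewrite lee_fin expR_ge0.
have Ifin : (\int[P]_w (expR (X w * t))%:E < +oo)%E.
  by rewrite ltey; apply: contraTneq H => ->.
have I1 : intg (fun w => expR (X w * t)).
  apply/integrableP; split; first by apply/measurable_EFinP; exact: measurable_expRX.
  under eq_integral do rewrite gee0_abs ?lee_fin ?expR_ge0//.
  exact: Ifin.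
split=> //; rewrite /mgf /Rintegral fine_gt0// Ifin andbT lt_neqAle I0 andbT.
by apply: contraTneq H => <-; rewrite le0_lneNy.
Qed.

Lemma log_mgfE t : 0 <= t -> fine (log_mgf P X t) = ln (mgf t).
Proof.
move=> t0; have [It Mt] := mgf_intg t0.
rewrite /log_mgf mmt_gen_funE -(fineK (integrable_fin_num measurableT It)).
by rewrite lne_EFin.
Qed.

Lemma expr_le_exp (y : R) k : (k <= 3)%N -> `|y| ^+ k <= 6 * expR `|y|.
Proof.
have y0 := normr_ge0 y; have e1 := expR_ge1Dx `|y|.
case: k => [|[|[|[|//]]]] _; rewrite ?expr0 ?expr1.
- lra.
- lra.
- by have := expR_ge1Dxn 1 y0; rewrite (_ : (1.+1`!)%N = 2%N)//; lra.
- by have := expR_ge1Dxn 2 y0; rewrite (_ : (2.+1`!)%N = 6%N)//; lra.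
Qed.

(** Powers up to 3 are dominated by [6 * expR |X - m|], and [X + |X - m|] is [2 * X - m] or [m]; the
    moment generating function at 2 thus suffices. *)
Lemma intg_moment (m : R) (g : R -> R) k : (k <= 3)%N -> measurable_fun setT g ->
  (forall y, `|g y| <= `|y| ^+ k) -> intg (fun w => expR (X w) * g (X w - m)).
Proof.
move=> k3 mg gk; have [I2 _] := mgf_intg (ler0n R 2).
apply: (@intg_dom _ _ _ _ _ (fun w => (6 * expR (- m)) * expR (X w * 2) + 6 * expR m)).
- apply: measurable_funM; last by apply: measurableT_comp => //; exact: measurable_funB.
  by apply: measurableT_comp; [exact: measurable_expR|exact: measurable_RV].
- move=> w; rewrite normrM (ger0_norm (expR_ge0 _)).
  apply: (@le_trans _ _ (6 * (expR (X w) * expR `|X w - m|))).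
    rewrite mulrCA ler_wpM2l ?expR_ge0//; apply: le_trans (gk _) _; exact: expr_le_exp.
  rewrite -!mulrA -mulrDr ler_wpM2l// -!expRD.
  have [h|h] := leP 0 (X w - m).
    by rewrite (ger0_norm h) (_ : X w + (X w - m) = - m + X w * 2) ?lerDl ?expR_ge0//; ring.
  by rewrite (ltr0_norm h) (_ : X w + - (X w - m) = m) ?lerDr ?expR_ge0//; ring.
- by apply: intgD; [exact: intgZ|exact: intg_cst].
Qed.

(** Differentiation under the integral on [(1/2, 3/2)], with a dominating function built from
    [expR (X * 2)] and a constant. *)
Lemma is_derive_mgf : is_derive (1 : R) 1 mgf mgf'.
Proof.
pose f (t : R) w := expR (X w * t).
pose G w : R := 6 * 2 * expR (X w * 2) + 6 * 2.
have in13 : `](1 / 2 : R), 3 / 2[%classic 1 by rewrite /= in_itv/=; apply/andP; split; lra.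
have If x : `](1 / 2 : R), 3 / 2[%classic x -> intg (f x).
  by rewrite /= in_itv/= => /andP[x1 x2]; apply: (mgf_intg _).1; lra.
have Df (x : R) w : is_derive x 1 (f^~ w) (X w * expR (X w * x)).
  rewrite mulrC.
  have : is_derive x 1 (fun t : R => X w * t) (X w).
    by apply: is_derive_eq; rewrite /GRing.scale/= mulr1.
  exact: is_derive1_comp.
have dfx (x : R) w : `](1 / 2 : R), 3 / 2[%classic x -> setT w -> derivable (f^~ w) x 1.
  by move=> _ _; case: (Df x w).
have p1 (x : R) w : partial1of2 f x w = X w * expR (X w * x).
  by rewrite /partial1of2 derive1E; apply: derive_val.
have G0 w : 0 <= G w by rewrite /G addr_ge0// mulr_ge0// expR_ge0.
have IG : intg G.
  by apply: intgD; [apply: intgZ; exact: (mgf_intg (ler0n R 2)).1|exact: intg_cst].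
have Gb (x : R) w : `](1 / 2 : R), 3 / 2[%classic x -> setT w -> `|partial1of2 f x w| <= G w.
  rewrite /= in_itv/= => /andP[x1 x2] _; rewrite p1 normrM (ger0_norm (expR_ge0 _)).
  have H : `|X w| <= 2 * (6 * expR `|X w / 2|).
    have := expr_le_exp (X w / 2) (isT : 1 <= 3)%N.
    by rewrite expr1 {1}normrM (@ger0_norm _ 2^-1)// ler_pdivrMr// mulrC.
  apply: le_trans (ler_wpM2r (expR_ge0 _) H) _.
  (* For [X >= 0] the bound [x <= 3/2] keeps the exponent below [2 * X]; for [X < 0] the bound
     [1/2 <= x] keeps it below 0. *)
  suff : expR (`|X w / 2| + X w * x) <= expR (X w * 2) + 1.
    by rewrite expRD /G; lra.
  have [h|h] := leP 0 (X w).
    rewrite ger0_norm ?divr_ge0//; apply: ler_wpDr => //; rewrite ler_expR; nra.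
  rewrite ltr0_norm ?pmulr_llt0//; apply: ler_wpDl; first exact: expR_ge0.
  have x0 : 0 <= x - 1 / 2 by lra.
  by rewrite -[leRHS]expR0 ler_expR; have := mulr_le0_ge0 (ltW h) x0; lra.
have D1 := derivable_under_integral measurableT in13 If dfx G0 IG Gb.
have D2 := differentiation_under_integral measurableT in13 If dfx G0 IG Gb.
have E : mgf' = 'D_1 mgf 1.
  rewrite -derive1E /mgf' D2; apply: eq_Rintegral => w _.
  by rewrite p1 mulr1.
by rewrite E; exact: derivableP.
Qed.

Definition tilted_mean : R := mgf' / mgf 1.

Lemma derive_log_mgf :
  (fun t : R => fine (log_mgf P X t))^`()%classic 1 = tilted_mean.
Proof.
have [_ M0] := mgf_intg (ler01 : 0 <= 1 :> R).
rewrite derive1E; apply: derive_val.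
(* The two functions are known to agree for [t >= 0] only, hence on the ball of radius 1 around
   1. *)
apply: (@near_eq_is_derive _ _ _ (@ln R \o mgf)).
  near=> t; rewrite /= log_mgfE//; near: t.
  by exists 1 => //= t /=; rewrite ltr_distl => /andP[? ?]; lra.
have : is_derive (mgf 1) 1 (@ln R) (mgf 1)^-1 by exact: is_derive1_ln.
move=> /is_derive1_comp /(_ is_derive_mgf).
by rewrite /tilted_mean mulrC.
Unshelve. all: by end_near. Qed.

End Moments.

Section TiltedMoments.
Context d (T : measurableType d) (R : realType) (P : probability T R).
Variable X : {RV P >-> R}.
Hypothesis fin_mgf : forall t : R, 0 <= t -> log_mgf P X t \is a fin_num.
Local Notation intg f := (P.-integrable setT (EFin \o f)).
Local Notation phi := (ln (mgf X 1)).
Local Notation m := (tilted_mean X).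

Lemma tilted_intg (g : R -> R) k : (k <= 3)%N -> measurable_fun setT g ->
  (forall y, `|g y| <= `|y| ^+ k) -> intg (fun w => expR (X w - phi) * g (X w - m)).
Proof.
move=> k3 mg gk; have := intgZ (expR (- phi)) (intg_moment fin_mgf m k3 mg gk).
by apply: eq_integrable => // w _ /=; rewrite mulrA -expRD addrC.
Qed.

Lemma tilted_moment0 : has_int P (fun w => expR (X w - phi)) 1.
Proof.
have [I1 M0] := mgf_intg fin_mgf (ler01 : 0 <= 1 :> R).
have E : (fun w => expR (X w - phi)) = fun w => (mgf X 1)^-1 * expR (X w * 1).
  by apply/funext => w; rewrite mulr1 expRD expRN lnK ?posrE// mulrC.
rewrite E; split; first exact: intgZ.
by rewrite RintegralZl// -/(mgf X 1) mulVf// gt_eqF.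
Qed.

Lemma tilted_moment1 : has_int P (fun w => expR (X w - phi) * (X w - m)) 0.
Proof.
have [I1 M0] := mgf_intg fin_mgf (ler01 : 0 <= 1 :> R).
split; first by apply: (@tilted_intg id 1) => // y; rewrite expr1.
have IX : intg (fun w => X w * expR (X w)).
  have := @intg_moment _ _ _ _ X fin_mgf 0 id 1 isT (@measurable_id _ _ _).
  move=> /(_ (fun y => lexx _)); apply: eq_integrable => // w _ /=.
  by rewrite subr0 mulrC.
have -> : \int[P]_w (expR (X w - phi) * (X w - m)) =
    \int[P]_w ((mgf X 1)^-1 * (X w * expR (X w)) - m * (mgf X 1)^-1 * expR (X w * 1)).
  apply: eq_Rintegral => w _.
  by rewrite mulr1 expRD expRN lnK ?posrE//; ring.
rewrite RintegralB//; [|exact: intgZ|exact: intgZ].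
rewrite !RintegralZl// -/(mgf' X) -/(mgf X 1) /tilted_mean.
by field; rewrite gt_eqF.
Qed.

Definition tilted_var : R := \int[P]_w (expR (X w - phi) * (X w - m) ^+ 2).
Definition tilted_abs3 : R := \int[P]_w (expR (X w - phi) * `|X w - m| ^+ 3).

Lemma tilted_moment2 : has_int P (fun w => expR (X w - phi) * (X w - m) ^+ 2) tilted_var.
Proof.
split=> //; apply: (@tilted_intg (fun y => y ^+ 2) 2) => // y.
by rewrite normrX.
Qed.

Lemma tilted_moment3 : has_int P (fun w => expR (X w - phi) * `|X w - m| ^+ 3) tilted_abs3.
Proof.
split=> //; apply: (@tilted_intg (fun y => `|y| ^+ 3) 3) => //.
  by apply: measurable_funX; exact: normr_measurable.
by move=> y; rewrite normrX normr_id.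
Qed.

Lemma tilted_var_ge0 : 0 <= tilted_var.
Proof. by apply: Rintegral_ge0 => w _; rewrite mulr_ge0 ?expR_ge0 ?sqr_ge0. Qed.

Lemma tilted_abs3_ge0 : 0 <= tilted_abs3.
Proof. by apply: Rintegral_ge0 => w _; rewrite mulr_ge0 ?expR_ge0 ?exprn_ge0. Qed.

(** The tilting density is positive, so a zero tilted variance would force [X = m] almost surely
    under [P] itself. *)
Lemma tilted_var_gt0 : non_degenerate P X -> 0 < tilted_var.
Proof.
move=> nd; rewrite lt_neqAle tilted_var_ge0 andbT; apply/eqP => v0; apply: nd.
exists m; have [I2 E2] := tilted_moment2.
have [+ _] := ae_eq_integral_abs P measurableT (measurable_int _ I2).
have -> : (\int[P]_(x in setT) `|(EFin \o (fun w => (expR (X w - phi) *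
  (X w - m) ^+ 2)%R)) x| = 0)%E.
  under eq_integral => w _.
    rewrite gee0_abs; last by rewrite /= lee_fin mulr_ge0 ?expR_ge0 ?sqr_ge0.
    over.
  rewrite -(fineK (integrable_fin_num measurableT I2)).
  by have -> : fine (\int[P]_x (EFin \o (fun w => (expR (X w - phi) *
    (X w - m) ^+ 2)%R)) x)%E = 0 by rewrite v0.
move=> /(_ erefl); apply: filterS => w /(_ I) /= /eqP.
by rewrite eqe mulf_eq0 gt_eqF ?expR_gt0//= sqrf_eq0 subr_eq0 => /eqP.
Qed.

End TiltedMoments.

Lemma has_int_same_law d d' (T : measurableType d) (T' : measurableType d') (R : realType)
  (P : probability T R) (P' : probability T' R) (X : {RV P >-> R}) (X' : {RV P' >-> R})
  (g : R -> R) v : same_law X X' -> measurable_fun setT g ->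
  has_int P' (fun w => g (X' w)) v -> has_int P (fun w => g (X w)) v.
Proof.
move=> XX' mg [I' E'].
have mg' : measurable_fun setT (EFin \o g) by exact/measurable_EFinP.
have mga : measurable_fun setT (fun x => `|(g x)%:E|%E) by exact: measurableT_comp.
have law (A : set R) : measurable A -> A `<=` setT -> distribution P X A = distribution P' X' A.
  by move=> mA _; exact: XX'.
have I1 : P.-integrable setT (EFin \o (fun w => g (X w))).
  apply/integrableP; split.
    by apply: (measurableT_comp mg'); exact: measurable_funP.
  have /integrableP[_] := I'.
  have := ge0_integral_distribution X' mga (fun _ => abse_ge0 _).
  have := ge0_integral_distribution X mga (fun _ => abse_ge0 _).
  rewrite (eq_measure_integral (distribution P' X'))// => -> E.
  by move: E => /= <-.
split=> //; rewrite -E' /Rintegral; congr fine.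
have := integral_distribution mg' I1; have := integral_distribution mg' I'.
by rewrite [X in _ -> X = _ -> _](eq_measure_integral (distribution P' X'))// => -> <-.
Qed.

(** * Independence within and between the rows of the array *)

Section Rows.
Context d (T : measurableType d) (R : realType) (P : probability T R).
Variable Xs : nat -> nat -> {RV P >-> R}.
Hypothesis ind : mutually_independent (fun ij : nat * nat => Xs ij.1 ij.2).
Let XX (ij : nat * nat) : {RV P >-> R} := Xs ij.1 ij.2.
Local Notation rs i n := (row_sum (fun j => Xs i j : T -> R) n).

Definition row_index (i n : nat) : {fset nat * nat} :=
  [fset ij in [seq (i, j) | j <- iota 0 n]]%fset.

Lemma mem_row_index i n ij : (ij \in row_index i n) = (ij.1 == i) && (ij.2 < n)%N.
Proof.
rewrite in_fset /=; apply/mapP/andP => [[j]|[/eqP <- jn]].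
  by rewrite mem_iota => /andP[_ jn] ->.
by exists ij.2; [rewrite mem_iota|case: ij {jn}].
Qed.

Lemma measurable_row_cylinders i n :
  measurable_fun setT (rs i n : g_sigma_algebraType (cylinders XX (row_index i n)) -> R).
Proof.
apply: measurable_sum => j.
by apply: (@measurable_cylinders _ _ _ _ _ XX _ (i, nat_of_ord j));
  rewrite mem_row_index eqxx /=.
Qed.

Lemma row_sum_indep_next i n : independent2 P (rs i n) (Xs i n).
Proof.
apply: (@independent_groups _ _ _ _ _ XX (row_index i n) [fset (i, n)]%fset) => //.
- rewrite fdisjointX1 mem_row_index /= ltnn andbF//.
- exact: measurable_row_cylinders.
- by apply: (@measurable_cylinders _ _ _ _ _ XX _ (i, n)); rewrite inE.
Qed.

Lemma row_sum_indep i k n : i != k -> independent2 P (rs i n) (rs k n).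
Proof.
move=> ik; apply: (@independent_groups _ _ _ _ _ XX (row_index i n) (row_index k n)) => //.
- apply/fdisjointP => ij; rewrite !mem_row_index => /andP[/eqP -> _].
  by rewrite (negbTE ik).
- exact: measurable_row_cylinders.
- exact: measurable_row_cylinders.
Qed.

End Rows.

Lemma cvg_in_probability_le d (T : measurableType d) (R : realType) (P : probability T R)
    (Y : nat -> T -> R) (Y0 : T -> R) :
  (forall eps e : R, 0 < eps -> 0 < e -> exists n0, forall n, (n0 <= n)%N ->
    (P [set w | (eps < `|Y n w - Y0 w|)%R] <= e%:E)%E) ->
  cvg_in_probability P Y Y0.
Proof.
move=> H eps eps0; apply/fine_cvgP; split.
  have [n0 Hn] := H eps 1 eps0 ltr01.
  exists n0 => // n /= nn; rewrite ge0_fin_numE//.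
  by apply: le_lt_trans (Hn n nn) _; rewrite ltry.
apply/cvgrPdist_le => e e0; have [n0 Hn] := H eps e eps0 e0.
exists n0 => // n /= nn; rewrite sub0r normrN ger0_norm ?fine_ge0//.
have fin : P [set w | eps < `|Y n w - Y0 w|] \is a fin_num.
  by rewrite ge0_fin_numE//; apply: le_lt_trans (Hn n nn) _; rewrite ltry.
by rewrite -lee_fin fineK//; exact: Hn.
Qed.

(** * From the tilted law to convergence in probability *)

Section Reduction.
Context d (T : measurableType d) (R : realType) (P : probability T R).
Variables (Xs : nat -> nat -> {RV P >-> R}) (N : nat -> nat) (phi m c s C : R).
Hypothesis ind : mutually_independent (fun ij : nat * nat => Xs ij.1 ij.2).
Local Notation Z i := (fun j => Xs i j : T -> R).
Hypothesis law : forall i n,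
  lindeberg_law P s C n (tilt (Z i) phi n) (centered (Z i) m n).
Hypothesis N_cvg : expR (- (c * n%:R)) * (N n)%:R @[n --> \oo] --> (1 : R).

Lemma cvg_sum_of_products p : 0 <= p <= 1 ->
  (forall eps, 0 < eps -> exists n0, forall n u D, (n0 <= n)%N ->
    lindeberg_law P s C n u D -> near_limit P (c - (m - phi)) p eps n u D) ->
  cvg_in_probability P (fun n w =>
    expR (- ((phi + c) * n%:R)) * sum_of_products Xs N n w) (fun=> p).
Proof.
move=> p01 lim; apply: cvg_in_probability_le => eps e eps0 e0.
have q0 : 0 < 2 + 8 / eps ^+ 2 by rewrite ltr_wpDr// divr_ge0// sqr_ge0.
(* The three bounds give [delta <= 1], [3 * delta <= eps / 2] and a final probability of at most
   [e]. *)
pose delta := Num.min 1 (Num.min (eps / 6) (e / (2 + 8 / eps ^+ 2))).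
have d0 : 0 < delta by rewrite !lt_min ltr01 !divr_gt0.
have d1 : delta <= 1 by rewrite ge_min lexx.
have d2 : delta <= eps / 6 by rewrite !ge_min lexx orbT.
have d3 : delta <= e / (2 + 8 / eps ^+ 2) by rewrite !ge_min lexx !orbT.
have [n1 H1] := lim _ d0.
have /cvgrPdist_le/(_ _ d0)[n2 _ H2] := N_cvg.
exists (maxn n1 n2) => n; rewrite geq_max => /andP[nn1 nn2].
have {}H2 := H2 n nn2.
pose V (i : 'I_(N n)) w := row_sum (Z i) n w - (phi + c) * n%:R.
pose b := expR (- (c * n%:R)).
have b0 : 0 < b by exact: expR_gt0.
(* This is the change of measure: a [P]-expectation carrying the factor [expR (V i)] is [b] times a
   tilted expectation. *)
have VE i w : expR (V i w) = b * tilt (Z i) phi n w.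
  by rewrite /tilt /b /V -expRD; congr expR; ring.
have VD i w : V i w = centered (Z i) m n w - (c - (m - phi)) * n%:R.
  by rewrite /V /centered; ring.
have mrs i : measurable_fun setT (row_sum (Z i) n).
  by apply: measurable_row_sum => j; exact: measurable_funP.
have mV i : measurable_fun setT (V i) by exact: measurable_funB.
have -> : [set w | (eps < `|expR (- ((phi + c) * n%:R)) * sum_of_products Xs N n w - p|)%R] =
    [set w | (eps < `|\sum_(i < N n) expR (V i w) - p|)%R].
  apply/funext => w /=; congr (is_true (_ < `|_ - _|)).
  rewrite /sum_of_products mulr_sumr; apply: eq_bigr => i _.
  by rewrite -expR_sum -expRD; congr expR; rewrite /V addrC.
apply: (@le_trans _ _ (2 * delta + 8 * delta / eps ^+ 2)%R%:E); last first.
  rewrite lee_fin; move: d3; rewrite ler_pdivlMr// => d3; apply: le_trans d3.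
  by rewrite mulrDr mulrC (mulrC 8) mulrA.
apply: (@concentration _ _ _ P (N n) V b p delta eps) => //.
- by rewrite (ltW d0).
- by lra.
- move=> i k ik.
  apply: (@independent2_comp _ _ _ P (row_sum (Z i) n) (row_sum (Z k) n)
    (fun x => x - (phi + c) * n%:R) (fun x => x - (phi + c) * n%:R)).
  + exact: measurable_funB.
  + exact: measurable_funB.
  + exact: row_sum_indep.
- move=> i; have [L1 _] := H1 _ _ _ nn1 (law i n).
  have [u0 [ui u1] mD _] := law i n.
  have -> : \int[P]_w cut (V i w) = b * wexp P (tilt (Z i) phi n) (centered (Z i) m n)
      \1_[set x : R | x <= (c - (m - phi)) * n%:R].
    rewrite -RintegralZl//; last by apply: wexp_intg => //; apply: bmeas_indic;
      exact: measurable_le.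
    by apply: eq_Rintegral => w _; rewrite /cut VE indic_bool VD subr_le0 mulrA.
  by rewrite -mulrBr normrM (gtr0_norm b0) ler_wpM2l// ltW.
- move=> i; have [_ L2] := H1 _ _ _ nn1 (law i n).
  have [u0 [ui u1] mD _] := law i n.
  have -> : \int[P]_w (expR (V i w) * expR (- `|V i w|)) =
      b * wexp P (tilt (Z i) phi n) (centered (Z i) m n)
        (fun x => expR (- `|x - (c - (m - phi)) * n%:R|)).
    rewrite -RintegralZl//; last exact: (wexp_intg u0 ui mD (bmeas_expRN_abs _)).
    by apply: eq_Rintegral => w _; rewrite VE VD mulrA.
  by rewrite ler_wpM2l// ltW.
- by rewrite distrC mulrC.
Qed.

End Reduction.

Theorem theorem5 (R : realType)
    (d0 : measure_display) (T0 : measurableType d0) (P0 : probability T0 R)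
    (X : {RV P0 >-> R})
    (d : measure_display) (T : measurableType d) (P : probability T R)
    (Xs : nat -> nat -> {RV P >-> R})
    (N : nat -> nat) (c : R) :
  non_degenerate P0 X ->
  (forall t : R, 0 <= t -> log_mgf P0 X t \is a fin_num) ->
  (forall i j : nat, same_law (Xs i j) X) ->
  mutually_independent (fun ij : nat * nat => Xs ij.1 ij.2) ->
  0 < c ->
  expR (- (c * n%:R)) * (N n)%:R @[n --> \oo] --> (1 : R) ->
  let phi := fun t : R => fine (log_mgf P0 X t) in
  let c1 : R := (phi^`()%classic) 1 - phi 1 in
  let Y := fun (n : nat) (w : T) =>
    expR (- ((phi 1 + c) * n%:R)) * sum_of_products Xs N n w in
  (c1 < c -> cvg_in_probability P Y (fun=> 1)) /\
  (c = c1 -> cvg_in_probability P Y (fun=> 1 / 2)).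
Proof.
move=> nd fin_mgf XsX ind _ N_cvg phi c1 Y.
have phi1 : phi 1 = ln (mgf X 1) by exact: log_mgfE.
have c1E : c1 = tilted_mean X - ln (mgf X 1) by rewrite /c1 derive_log_mgf// phi1.
rewrite /Y phi1 c1E.
set f := ln (mgf X 1); set m := tilted_mean X.
pose s := Num.sqrt (tilted_var X).
have s0 : 0 < s by rewrite sqrtr_gt0 tilted_var_gt0.
have s2 : s ^+ 2 = tilted_var X by rewrite sqr_sqrtr// tilted_var_ge0.
pose C := tilted_abs3 X + `|s| ^+ 3.
have C0 : 0 <= C by rewrite addr_ge0 ?tilted_abs3_ge0// exprn_ge0.
have mf : measurable_fun setT (fun x : R => expR (x - f)).
  by apply: measurableT_comp; [exact: measurable_expR|exact: measurable_funB].
have mm : measurable_fun setT (fun x : R => x - m) by exact: measurable_funB.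
(* All entries share the law of [X], so [s] and [C] are the same for every row and every [n]. *)
have law i n : lindeberg_law P s C n (tilt (fun j => Xs i j : T -> R) f n)
    (centered (fun j => Xs i j : T -> R) m n).
  have mZ j : measurable_fun setT (Xs i j : T -> R) by exact: measurable_funP.
  have I := row_sum_indep_next ind i.
  have M0 j := has_int_same_law (XsX i j) mf (tilted_moment0 fin_mgf).
  have M1 j := has_int_same_law (XsX i j) (measurable_funM mf mm) (tilted_moment1 fin_mgf).
  have M2 j := has_int_same_law (XsX i j) (measurable_funM mf (measurable_funX 2 mm))
    (tilted_moment2 fin_mgf).
  have M3 j := has_int_same_law (XsX i j) (measurable_funM mf (measurable_funX 3
    (measurableT_comp (@normr_measurable R setT) mm))) (tilted_moment3 fin_mgf).
  rewrite -s2 in M2.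
  split.
  - by move=> w; exact: expR_ge0.
  - exact: has_int_tilt.
  - exact: measurable_centered.
  - move=> M g MM0 tg bg; exact: (lindeberg mZ I M0 M1 M2 M3).
(* The drift [kappa] is [c - c1]: positive in the first case, zero in the second. *)
split=> [cc1|cc1]; apply: (cvg_sum_of_products ind law N_cvg).
- by rewrite ler01 lexx.
- by move=> e e0; apply: near_limit_super => //; [exact: ltW|rewrite subr_gt0].
- by apply/andP; split; lra.
- move=> e e0; rewrite cc1 subrr; apply: near_limit_crit => //; exact: ltW.
Qed.
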